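(* Let $n,k$ be integers with $1\le k<n$, let $K$ and $L$ be origin-symmetric star bodies in $\mathbb{R}^n$ such that $L\subset K$, and let $\mu$ be a measure on $\mathbb{R}^n$ with even non-negative continuous density. Then $$\mu(K)-\mu(L)\le\frac{n}{n-k}\,c_{n,k}^k\,|K|^{\frac kn}\,d_{\rm ovr}^k(K,\mathcal{BP}_k^n)\,\max_{F\in{\rm Gr}_{n-k}}\big(\mu(K\cap F)-\mu(L\cap F)\big).$$
   Context: $|\cdot|$ denotes volume (Lebesgue measure) of the appropriate dimension, ${\rm Gr}_{n-k}$ is the Grassmannian of $(n-k)$-dimensional linear subspaces of $\mathbb{R}^n$, and $\omega_m$ is the volume of the unit Euclidean ball in $\mathbb{R}^m$. The constant $c_{n,k}$ is the positive number defined by $c_{n,k}^k=\omega_n^{\frac{n-k}{n}}/\omega_{n-k}$. If $\mu$ has density $f$, then $\mu(B)=\int_B f$ for Borel $B\subset\mathbb{R}^n$, and for $F\in{\rm Gr}_{n-k}$ one writes $\mu(B\cap F)=\int_{B\cap F}f$, where the restriction of $f$ to $F$ is integrated against Lebesgue measure on $F$. A closed bounded set $K\subset\mathbb{R}^n$ is a star body if every straight line through the origin crosses the boundary of $K$ at exactly two points different from the origin, the origin is an interior point of $K$, and the Minkowski functional $\|x\|_K=\min\{a\ge 0: x\in aK\}$ is continuous on $\mathbb{R}^n$. Its radial function is $\rho_K(x)=\|x\|_K^{-1}$, $x\ne 0$. Origin-symmetric means $K=-K$. The $(n-k)$-dimensional spherical Radon transform $R_{n-k}:C(S^{n-1})\to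 C({\rm Gr}_{n-k})$ is $R_{n-k}g(E)=\int_{S^{n-1}\cap E}g(\theta)\,d\theta$, where $d\theta$ is the (non-normalized) Lebesgue measure on the sphere $S^{n-1}\cap E$ (counting measure if $\dim E=1$). An origin-symmetric star body $D$ in $\mathbb{R}^n$ is a generalized $k$-intersection body, written $D\in\mathcal{BP}_k^n$, if there exists a finite non-negative Borel measure $\mu_D$ on ${\rm Gr}_{n-k}$ such that for every $g\in C(S^{n-1})$, $\int_{S^{n-1}}\rho_D^k(\theta)g(\theta)\,d\theta=\int_{{\rm Gr}_{n-k}}R_{n-k}g(H)\,d\mu_D(H)$. The outer volume ratio distance is $d_{\rm ovr}(K,\mathcal{BP}_k^n)=\inf\{(|D|/|K|)^{1/n}: K\subset D,\ D\in\mathcal{BP}_k^n\}$, and $d_{\rm ovr}^k$ denotes its $k$-th power. *)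

(* Defs.v *)
From HB Require Import structures.
From mathcomp Require Import all_boot all_order all_algebra.
From mathcomp Require Import all_classical all_reals all_analysis.
From mathcomp Require Import measurable_realfun.
Set Implicit Arguments.
Unset Strict Implicit.
Unset Printing Implicit Defensive.
Import Order.TTheory GRing.Theory Num.Theory.
Import numFieldNormedType.Exports.
Local Open Scope classical_set_scope.
Local Open Scope ring_scope.

Notation borel T := (g_sigma_algebraType (@open T)).

Section image_measure.
Context d1 d2 (T1 : measurableType d1) (T2 : measurableType d2) (R : realType).
Variables (mu : {measure set T1 -> \bar R}) (f : T1 -> T2).

Definition image_measure (_ : measurable_fun setT f) : set T2 -> \bar R :=
  pushforward mu f.

Hypothesis mf : measurable_fun setT f.

Let image_measure0 : image_measure mf set0 = 0%E.
Proof. by rewrite /image_measure /pushforward preimage_set0 measure0. Qed.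

Let image_measure_ge0 A : (0 <= image_measure mf A)%E.
Proof. exact: measure_ge0. Qed.

Let image_measure_sigma_additive : semi_sigma_additive (image_measure mf).
Proof. exact: measure_semi_sigma_additive. Qed.

HB.instance Definition _ := isMeasure.Build _ _ _ (image_measure mf)
  image_measure0 image_measure_ge0 image_measure_sigma_additive.

End image_measure.

Section borel_rows.
Context {R : realType}.

Lemma measurable_coord n (i : 'I_n) :
  measurable_fun setT (fun x : borel 'rV[R]_n => x ord0 i : measurableTypeR R).
Proof.
apply: (measurability _ (RGenOpens.measurableE R)).
move=> _ [_ [a [b ->] <-]]; rewrite setTI; apply: sub_sigma_algebra.
have /continuousP : continuous (fun x : 'rV[R]_n => x ord0 i).
  exact: coord_continuous.
by apply; exact: interval_open.
Qed.

Lemma measurable_row d (T : measurableType d) n (h : T -> borel 'rV[R]_n) :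
  (forall i, measurable_fun setT (fun t => h t ord0 i : measurableTypeR R)) ->
  measurable_fun setT h.
Proof.
move=> mh; apply: (@measurability _ _ T (borel 'rV[R]_n) _ _ (@open 'rV[R]_n)) => //.
move=> _ [U oU <-]; rewrite setTI.
pose box (q : {ffun 'I_n -> rat * rat}) := [set x : 'rV[R]_n | forall i,
  x ord0 i \in `]ratr (q i).1, ratr (q i).2[ ].
have -> : U = \bigcup_q (if `[< box q `<=` U >] then box q else set0).
  apply/seteqP; split=> [x Ux|x [q _]]; last by case: asboolP => // qU /qU.
  have /nbhs_ballP[e/= e0 exU] : nbhs x U by exact: open_nbhs_nbhs.
  have lo i : {q : rat | ratr q \in `]x ord0 i - e, x ord0 i[}.
    by apply/cid/rat_in_itvoo; rewrite gtrBl.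
  have hi i : {q : rat | ratr q \in `]x ord0 i, x ord0 i + e[}.
    by apply/cid/rat_in_itvoo; rewrite ltrDl.
  exists [ffun i => (sval (lo i), sval (hi i))] => //.
  case: asboolP => [_ i|].
    rewrite ffunE /= in_itv /=.
    have := svalP (lo i); have := svalP (hi i).
    by rewrite !in_itv /= => /andP[-> _] /andP[_ ->].
  case=> y /= yq; apply: exU; split=> // j i; rewrite (ord1 j).
  have := yq i; rewrite ffunE /= /ball /= in_itv /= => /andP[y1 y2].
  have := svalP (lo i); have := svalP (hi i).
  rewrite !in_itv /= => /andP[h1 h2] /andP[l1 l2].
  by rewrite distrC ltr_distl (lt_trans l1 y1) (lt_trans y2 h2).
rewrite preimage_bigcup; apply: countable_bigcupT_measurable => [|q].
  exact: countableP.
case: asboolP => _; last by rewrite preimage_set0.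
have -> : h @^-1` box q = \bigcap_(i in [set: 'I_n])
   ((fun t => h t ord0 i) @^-1` `]ratr (q i).1, ratr (q i).2[%classic).
  by apply/seteqP; split=> [t /= tq i _|t /= tq i]; [exact: tq|exact: tq].
apply: fin_bigcap_measurable => [|i _]; first exact: finite_finset.
by rewrite -[X in measurable X]setTI; exact: mh.
Qed.

End borel_rows.

Section lebesgue.
Context {R : realType}.

Definition cons_row n (p : measurableTypeR R * borel 'rV[R]_n) :
  borel 'rV[R]_n.+1 := row_mx (const_mx p.1 : 'rV_1) p.2.

Lemma measurable_cons_row n : measurable_fun setT (@cons_row n).
Proof.
apply: measurable_row => i; rewrite /cons_row.
case: (split_ordP (i : 'I_(1 + n))) => j ->.
  rewrite [X in measurable_fun _ X](_ : _ = fst)//.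
  by apply/funext => p; apply: etrans (row_mxEl _ _ _ _) _; rewrite mxE.
rewrite [X in measurable_fun _ X](_ : _ = (fun x : borel 'rV[R]_n => x ord0 j : measurableTypeR R) \o snd); last first.
  by apply/funext => p; exact: row_mxEr.
exact: (measurableT_comp (measurable_coord j) measurable_snd).
Qed.

Section step.
Variables (n : nat) (mu : {sigma_finite_measure set (borel 'rV[R]_n) -> \bar R}).

Definition lebesgue_cons : set (borel 'rV[R]_n.+1) -> \bar R :=
  image_measure (lebesgue_measure \x mu)%E (@measurable_cons_row n).

HB.instance Definition _ := Measure.on lebesgue_cons.

Let lebesgue_cons_sigma_finite : sigma_finite setT lebesgue_cons.
Proof.
have [F [UF ndF Ffin]] :=
  (sigma_finiteP _ _).1 (sigma_finiteT (@lebesgue_measure R)).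
have [G [UG ndG Gfin]] := (sigma_finiteP _ _).1 (sigma_finiteT mu).
pose uncons (x : borel 'rV[R]_n.+1) : measurableTypeR R * borel 'rV[R]_n :=
  (x ord0 ord0, rsubmx (x : 'rV[R]_(1 + n))).
have unconsK : cancel (@cons_row n) uncons.
  move=> [x v]; rewrite /uncons /cons_row /=; congr pair.
    have e : ord0 = lshift n (ord0 : 'I_1) :> 'I_(1 + n) by exact/val_inj.
    apply: etrans (congr1 (row_mx (const_mx x : 'rV_1) v ord0) e) _.
    by rewrite row_mxEl mxE.
  by rewrite row_mxKr.
have muncons : measurable_fun setT uncons.
  apply: measurable_fun_pair.
    exact: measurable_coord.
  apply: measurable_row => i.
  rewrite [X in measurable_fun _ X](_ : _ = (fun x : borel 'rV[R]_n.+1 =>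
     x ord0 (rshift 1 i) : measurableTypeR R)); last first.
    by apply/funext => x; rewrite mxE.
  exact: measurable_coord.
exists (fun k => uncons @^-1` (F k `*` G k)).
  apply/seteqP; split=> // x _.
  have [i _ Fi] : (\bigcup_i F i) (x ord0 ord0) by rewrite -UF.
  have [j _ Gj] : (\bigcup_i G i) (uncons x).2 by rewrite -UG.
  exists (maxn i j) => //; split.
    by move: Fi; exact/subsetPset/ndF/leq_maxl.
  by move: Gj; exact/subsetPset/ndG/leq_maxr.
move=> k; have [mF Foo] := Ffin k; have [mG Goo] := Gfin k; split.
  by rewrite -[X in measurable X]setTI; apply: muncons => //; exact: measurableX.
have -> : lebesgue_cons (uncons @^-1` (F k `*` G k)) =
    (lebesgue_measure \x mu)%E (F k `*` G k).
  have unconsE : @cons_row n @^-1` (uncons @^-1` (F k `*` G k)) = F k `*` G k.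
    by rewrite -comp_preimage (_ : uncons \o _ = id)//; exact/funext.
  by rewrite -[in RHS]unconsE.
rewrite [ltLHS](_ : _ = lebesgue_measure (F k) * mu (G k))%E.
  by rewrite lte_mul_pinfty// ge0_fin_numE.
exact: product_measure1E.
Qed.

HB.instance Definition _ := Measure_isSigmaFinite.Build _ _ _ lebesgue_cons
  lebesgue_cons_sigma_finite.

End step.

(* n-dimensional Lebesgue measure on the Borel sets, as an iterated product. *)
Fixpoint lebesgue n : {sigma_finite_measure set (borel 'rV[R]_n) -> \bar R} :=
  match n with
  | 0 => \d_(0 : borel 'rV[R]_0)
  | n'.+1 => lebesgue_cons (lebesgue n')
  end.

End lebesgue.

Section euclidean.
Context {R : realType}.

(* The norm that the library puts on matrices is the sup norm. *)
Definition enorm n (x : 'rV[R]_n) : R := Num.sqrt (\sum_i x ord0 i ^+ 2).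

Definition unit_ball n : set 'rV[R]_n := [set x | enorm x <= 1].

Definition unit_sphere n : set 'rV[R]_n := [set x | enorm x = 1].

Lemma measurable_enorm n :
  measurable_fun setT (fun x : borel 'rV[R]_n => enorm x : measurableTypeR R).
Proof.
rewrite [X in measurable_fun _ X](_ : _ = fun x : borel 'rV[R]_n =>
  (\sum_i (x : 'rV[R]_n) ord0 i ^+ 2) `^ 2^-1); last first.
  by apply/funext => x; rewrite powR12_sqrt// sumr_ge0// => i _; exact: sqr_ge0.
apply: (measurableT_comp (measurable_powR 2^-1)).
apply: measurable_sum => i; apply: measurable_funX; exact: measurable_coord.
Qed.

Lemma measurable_unit_ball n : measurable (@unit_ball n : set (borel 'rV[R]_n)).
Proof.
have -> : @unit_ball n = setT `&` @enorm n @^-1` `]-oo, 1].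
  by rewrite setTI; apply/seteqP; split=> x /=; rewrite in_itv.
exact: measurable_enorm.
Qed.

Definition normalize n (x : borel 'rV[R]_n) : borel 'rV[R]_n :=
  (enorm x)^-1 *: (x : 'rV[R]_n).

Lemma measurable_normalize n : measurable_fun setT (@normalize n).
Proof.
apply: measurable_row => i.
rewrite [X in measurable_fun _ X](_ : _ = fun x : borel 'rV[R]_n =>
  enorm x `^ (-1) * (x : 'rV[R]_n) ord0 i); last first.
  by apply/funext => x; rewrite mxE powR_inv1// sqrtr_ge0.
apply: measurable_funM.
  apply: (measurableT_comp (measurable_powR (-1))).
  exact: measurable_enorm.
exact: measurable_coord.
Qed.

(* Surface measure on the unit sphere: by polar coordinates a Borel set A of
   directions has measure n times the volume of the cone
   {x : 0 < |x| <= 1, x / |x| \in A}. It is carried by the unit sphere (for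
   0 < n), and for n = 1 it is the counting measure on {-1, 1}. *)
Definition sphere_measure n : set (borel 'rV[R]_n) -> \bar R :=
  mscale n%:R%:nng
    (image_measure (mrestr (@lebesgue R n) (@measurable_unit_ball n))
       (@measurable_normalize n)).

HB.instance Definition _ n := Measure.on (@sphere_measure n).

End euclidean.
Arguments unit_ball {R} n _.
Arguments unit_sphere {R} n _.
Arguments sphere_measure {R} n _.

Section frames.
Context {R : realType}.

(* The rows of A form an orthonormal basis of F. *)
Definition is_frame n m (F : {vspace 'rV[R]_n}) (A : 'M[R]_(m, n)) :=
  A *m A^T = 1%:M /\ forall x : 'rV[R]_n, (x \in F) = (x <= A)%MS.

Lemma gram_schmidt m n (B : 'M[R]_(m, n)) : row_free B ->
  exists2 A : 'M[R]_(m, n), A *m A^T = 1%:M & (A :=: B)%MS.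
Proof.
elim: m => [|m IH] in B *.
  by exists B => //; rewrite [LHS]flatmx0 [RHS]flatmx0.
rewrite -[m.+1]/(1 + m)%N in B *; rewrite -(vsubmxK B).
set u := usubmx B; set B' := dsubmx B => freeB.
have rkB : \rank (col_mx u B') = (1 + m)%N by exact/eqP.
have rkB' : \rank B' = m.
  apply/eqP; rewrite eqn_leq rank_leq_row /=.
  rewrite -(leq_add2l 1) -[leqLHS]rkB -addsmxE.
  apply: leq_trans (mxrank_adds_leqif u B') _.
  by rewrite leq_add2r rank_leq_row.
have [A' A'1 A'B] := IH B' (introT eqP rkB').
pose w := u - u *m A'^T *m A'.
have wA' : w *m A'^T = 0.
  by rewrite mulmxBl -!mulmxA A'1 mulmx1 subrr.
have w0 : w != 0.
  apply/eqP => /eqP; rewrite subr_eq0 => /eqP uA'.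
  have uB' : (u <= B')%MS by rewrite -A'B uA' submxMl.
  have : (\rank (col_mx u B') <= m)%N.
    rewrite -addsmxE -[leqRHS]rkB'; apply: mxrankS.
    by rewrite addsmx_sub uB'; exact: submx_refl.
  by rewrite rkB add1n ltnn.
set s := \sum_i w ord0 i ^+ 2.
have wwT : w *m w^T = s%:M.
  apply/matrixP => i j; rewrite !ord1 !mxE eqxx mulr1n.
  by apply: eq_bigr => k _; rewrite [w^T _ _]mxE expr2.
have s0 : 0 < s.
  rewrite lt_neqAle sumr_ge0 ?andbT; last by move=> i _; exact: sqr_ge0.
  apply: contra w0 => /eqP/esym/eqP; rewrite psumr_eq0 => [/allP h|i _]; last exact: sqr_ge0.
  apply/eqP/matrixP => i j; rewrite ord1 [RHS]mxE; apply/eqP.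
  by have := h j (mem_index_enum _); rewrite /= sqrf_eq0.
pose c := (Num.sqrt s)^-1.
have c0 : c != 0 by rewrite invr_eq0 gt_eqF// sqrtr_gt0.
have cw : (c *: w) *m (c *: w)^T = 1%:M.
  rewrite linearZ /= -scalemxAl -scalemxAr wwT scalerA scale_scalar_mx -expr2.
  by rewrite exprVn sqr_sqrtr ?ltW// mulVf// gt_eqF.
exists (col_mx (c *: w) A').
  rewrite tr_col_mx mul_col_row A'1 cw -scalemxAl wA' scaler0.
  rewrite -[A' *m _]trmxK trmx_mul trmxK -scalemxAl wA' scaler0 trmx0.
  by rewrite -scalar_mx_block.
apply/eqmxP; rewrite -!addsmxE; apply/andP; split; rewrite addsmx_sub; apply/andP; split.
- apply: scalemx_sub; apply: addmx_sub; first exact: addsmxSl.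
  rewrite eqmx_opp; apply: submx_trans (submxMl _ _) _.
  by rewrite A'B addsmxSr.
- by rewrite A'B addsmxSr.
- have -> : u = w + u *m A'^T *m A' by rewrite /w subrK.
  apply: addmx_sub.
    by rewrite -(eqmx_scale w c0) addsmxSl.
  by apply: submx_trans (submxMl _ _) _; exact: addsmxSr.
- by rewrite -A'B addsmxSr.
Qed.

Lemma exists_frame n m (F : {vspace 'rV[R]_n}) : \dim F = m ->
  exists A : 'M[R]_(m, n), is_frame F A.
Proof.
move=> <-; pose B : 'M[R]_(\dim F, n) := \matrix_i (vbasis F)`_i.
have uB (u : 'rV_(\dim F)) : u *m B = \sum_i u ord0 i *: (vbasis F)`_i.
  by rewrite mulmx_sum_row; apply: eq_bigr => i _; rewrite rowK.
have BF (x : 'rV[R]_n) : (x \in F) = (x <= B)%MS.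
  apply/idP/submxP => [xF|[u ->]].
    exists (\row_i coord (vbasis F) i x); rewrite uB {1}(coord_vbasis xF).
    by apply: eq_bigr => i _; rewrite mxE.
  rewrite uB; apply: memv_suml => i _; apply: memvZ.
  by apply: vbasis_mem; rewrite mem_nth// size_tuple.
have /gram_schmidt[A A1 AB] : row_free B.
  rewrite -kermx_eq0; apply/rowV0P => u /sub_kermxP; rewrite uB => u0.
  have /freeP := basis_free (vbasisP F).
  by move=> /(_ _ u0) h; apply/rowP => i; rewrite h mxE.
by exists A; split=> // x; rewrite BF AB.
Qed.

End frames.

(* Gr R n k is the Grassmannian Gr_(n-k) of (n - k)-dimensional subspaces of
   R^n. It is indexed by the codimension k so that it is never empty. *)
Definition Gr (R : realType) (n k : nat) : Type :=
  {F : {vspace 'rV[R]_n} | \dim F == (n - k)%N}.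

Lemma Gr_inhabited (R : realType) n k :
  exists F : {vspace 'rV[R]_n}, \dim F == (n - k)%N.
Proof.
pose X := take (n - k) (vbasis (fullv : {vspace 'rV[R]_n})).
exists <<X>>%VS; apply/eqP.
have fX : free X.
  have := basis_free (vbasisP (fullv : {vspace 'rV[R]_n})).
  by rewrite -{1}(cat_take_drop (n - k) (vbasis _)) => /catl_free.
move: fX; rewrite /free => /eqP ->.
by rewrite size_takel// size_tuple dimvf /dim /= mul1n leq_subr.
Qed.

HB.instance Definition _ (R : realType) n k :=
  Choice.copy (Gr R n k) {F : {vspace 'rV[R]_n} | \dim F == (n - k)%N}.
HB.instance Definition _ (R : realType) n k := isPointed.Build (Gr R n k)
  (exist _ (xchoose (Gr_inhabited R n k)) (xchooseP (Gr_inhabited R n k))).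

(* A chosen orthonormal basis of F, as the rows of a matrix. *)
Definition frame (R : realType) n k (F : Gr R n k) : 'M[R]_(n - k, n) :=
  projT1 (cid (exists_frame (eqP (valP F)))).

(* The matrix of the orthogonal projection onto F; it does not depend on the
   orthonormal basis. The usual (compact, metrizable) topology of the
   Grassmannian is the one induced by F |-> orthoproj F. *)
Definition orthoproj (R : realType) n k (F : Gr R n k) : 'M[R]_n :=
  (frame F)^T *m frame F.

HB.instance Definition _ (R : realType) n k := Topological.copy (Gr R n k)
  (initial_topology (@orthoproj R n k)).
HB.instance Definition _ (R : realType) n k := PointedTopological.on (Gr R n k).

Section sections.
Context {R : realType} (n k : nat) (F : Gr R n k).

(* Isometry of R^(n-k) onto F. *)
Definition embed (u : borel 'rV[R]_(n - k)) : borel 'rV[R]_n :=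
  (u : 'rV[R]_(n - k)) *m frame F.

Lemma measurable_embed : measurable_fun setT embed.
Proof.
apply: measurable_row => j.
rewrite [X in measurable_fun _ X](_ : _ = fun u : borel 'rV[R]_(n - k) =>
  \sum_i (u : 'rV[R]_(n - k)) ord0 i * frame F i j); last first.
  by apply/funext => u; rewrite mxE.
apply: measurable_sum => i; apply: measurable_funM; last exact: measurable_cst.
exact: measurable_coord.
Qed.

(* Lebesgue measure on F, as a measure on R^n carried by F. *)
Definition lebesgue_on : set (borel 'rV[R]_n) -> \bar R :=
  image_measure (lebesgue (n - k)) measurable_embed.

HB.instance Definition _ := Measure.on lebesgue_on.

(* Surface measure on the unit sphere of F, as a measure on R^n. *)
Definition sphere_measure_on : set (borel 'rV[R]_n) -> \bar R :=
  image_measure (sphere_measure (n - k)) measurable_embed.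

HB.instance Definition _ := Measure.on sphere_measure_on.

(* Spherical Radon transform: the value at F of R_(n-k) g. *)
Definition radon (g : 'rV[R]_n -> R) : \bar R :=
  (\int[sphere_measure_on]_(x in unit_sphere n `&` [set` val F]) (g x)%:E)%E.

(* mu (B `&` F), for mu the measure with density f. *)
Definition section_mass (f : 'rV[R]_n -> R) (B : set 'rV[R]_n) : \bar R :=
  (\int[lebesgue_on]_(x in B `&` [set` val F]) (f x)%:E)%E.

End sections.

Section bodies.
Context {R : realType} (n : nat).
Implicit Types (K D : set 'rV[R]_n) (x : 'rV[R]_n).

Definition boundary K : set 'rV[R]_n := closure K `\` interior K.

(* For a star body the infimum is a minimum. *)
Definition minkowski K x : R :=
  inf [set a : R | 0 <= a /\ exists2 y, K y & x = a *: y].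

Definition line x : set 'rV[R]_n := [set t *: x | t in [set: R]].

Definition star_body K := [/\ closed K, bounded_set K,
  forall u, u != 0 -> exists p q, p != q /\
    (line u `&` boundary K) `\ (0 : 'rV[R]_n) = [set p; q],
  interior K 0 & continuous (minkowski K)].

Definition origin_symmetric K := [set - x | x in K] = K.

Definition radial K x : R := (minkowski K x)^-1.

(* The class BP_k^n. *)
Definition gen_intersection_body k D :=
  [/\ star_body D, origin_symmetric D &
   exists nu : {finite_measure set (borel (Gr R n k)) -> \bar R},
   forall g : 'rV[R]_n -> R, {within unit_sphere n, continuous g} ->
     (\int[sphere_measure n]_(x in unit_sphere n) (radial D x ^+ k * g x)%:E =
      \int[nu]_F radon F g)%E].

Definition vol K : R := fine (lebesgue n K).

(* Extended-real valued: the infimum of the empty set is +oo. *)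
Definition d_ovr k K : \bar R :=
  ereal_inf [set ((vol D / vol K) `^ n%:R^-1)%:E |
             D in [set D | K `<=` D /\ gen_intersection_body k D]].

Definition has_density (mu : set (borel 'rV[R]_n) -> \bar R)
    (f : 'rV[R]_n -> R) :=
  forall B : set (borel 'rV[R]_n), measurable B ->
    mu B = (\int[lebesgue n]_(x in B) (f x)%:E)%E.

End bodies.

Definition omega (R : realType) (m : nat) : R := vol (unit_ball m : set 'rV[R]_m).

(* The positive number with
   c_nk ^+ k = omega n `^ ((n - k) / n) / omega (n - k). *)
Definition c_nk (R : realType) (n k : nat) : R :=
  (omega R n `^ ((n - k)%N%:R / n%:R) / omega R (n - k)) `^ k%:R^-1.

(* Main.v *)
Require Import Defs.
From mathcomp Require Import all_boot all_order all_algebra.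
From mathcomp Require Import all_classical all_reals all_analysis.
From mathcomp Require Import measurable_realfun ring lra.
Set Implicit Arguments.
Unset Strict Implicit.
Unset Printing Implicit Defensive.
Import Order.TTheory GRing.Theory Num.Theory.
Import numFieldNormedType.Exports.
Local Open Scope classical_set_scope.
Local Open Scope ring_scope.

(** Let [m = n - k], let [h] be the density [f] cut off to [K `\` L], and for
    [x != 0] put [P_j x = \int_0^oo r^(j-1) h (r x) dr].  Polar coordinates
    (lemma [polar]) write [mu K - mu L] as the integral of [P_n] over the unit
    sphere of R^n, and the mass of the section by an [m]-dimensional subspace
    [F] as the integral of [P_m] over the unit sphere of [F], which is the
    spherical Radon transform of [P_m] at [F] (lemma [slice_mass_polar]).

    Star bodies have continuous radial functions, so [P_m] is continuous away
    from the origin (lemma [ray_mass_continuous]) and is an admissible test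
    function in the definition of a generalized [k]-intersection body.  Let [D]
    be such a body containing [K], with measure [nu], and let [M] be the
    largest difference of section masses.  If [h (r x) != 0], then [r x] lies
    in [D], that is [r <= rho_D x], hence [P_n <= rho_D^k P_m] and
    [mu K - mu L <= \int rho_D^k P_m = \int (radon F P_m) dnu F <= M nu(Gr)].
    The test function [1] shows that [m omega_m nu(Gr)] is the integral of
    [rho_D^k] over the sphere; by Hoelder it is at most
    [(n omega_n)^(m/n) (n |D|)^(k/n)] (lemma [radial_moment_le]), as
    [n |D|] is the integral of [rho_D^n].  This is the asserted bound with
    [|D|^(k/n)] in place of [|K|^(k/n) d_ovr^k] (lemma
    [body_mass_le_intersection]), and it remains to take the infimum over [D].

    When no body of the class contains [K], the distance is [+oo] and the
    right-hand side is [+oo], unless [M = 0], where the product is [0].  In this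
    last case every section mass of the nonnegative continuous [f] outside [L]
    vanishes, so [f] vanishes on the interior of [K] outside [L] and the
    left-hand side is [0] as well (lemma [body_mass_vanish]).

    The maximum over the Grassmannian is attained because, as a function of an
    orthonormal frame [A] of [F], the mass of the section is the integral of
    [P_m (u A)] over the unit sphere of R^m, which is continuous on the compact
    set of orthonormal frames.  Two frames of the same subspace differ by an
    orthogonal matrix, and Lebesgue measure is invariant under those (lemma
    [integral_lebesgue_orthogonal]), so a maximizing frame can be replaced by
    the chosen frame of the subspace that it spans (lemma [maximal_section]). *)

(** * Change of variables and cubes for the iterated Lebesgue measure *)

Section lebesgue_row.
Context {R : realType}.
Local Open Scope ereal_scope.

Lemma measurable_affine n (a : R) (b : 'rV[R]_n) :
  measurable_fun setT (fun x : borel 'rV[R]_n => (a *: (x : 'rV[R]_n) + b)%R : borel 'rV[R]_n).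
Proof.
apply: measurable_row => i.
rewrite [X in measurable_fun _ X](_ : _ = fun x : borel 'rV[R]_n =>
  (a * (x : 'rV[R]_n) ord0 i + b ord0 i)%R); last first.
  by apply/funext => x; rewrite !mxE.
apply: measurable_funD => //; apply: measurable_funM => //.
exact: measurable_coord.
Qed.

Lemma lebesgue_measure_affine (a b : R) (A : set (measurableTypeR R)) :
  (0 < a)%R -> measurable A ->
  lebesgue_measure ((fun t => a * t + b)%R @^-1` A) = a^-1%:E * lebesgue_measure A.
Proof.
move=> a0 mA.
have mf : measurable_fun setT (fun t : measurableTypeR R => (a * t + b)%R : measurableTypeR R).
  by apply: measurable_funD => //; exact: measurable_funM.
pose k : {nonneg R} := NngNum (ltW a0).
rewrite (@lebesgue_measure_unique R (mscale k (image_measure lebesgue_measure mf)) _ A mA).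
  by rewrite /mscale /= muleA -EFinM mulVf ?gt_eqF// mul1e.
move=> _ [[x y]/= _ <-].
rewrite /mscale /= /image_measure /pushforward /=.
have -> : (fun t => a * t + b)%R @^-1` `]x, y]%classic = `](a^-1 * (x - b))%R, (a^-1 * (y - b))%R]%classic.
  apply/seteqP; split=> t /=; rewrite !in_itv /= => /andP[h1 h2].
    by rewrite ltr_pdivrMl// ler_pdivlMl// ltrBlDr lerBrDr h1.
  by move: h1 h2; rewrite ltr_pdivrMl// ler_pdivlMl// ltrBlDr lerBrDr => -> ->.
rewrite !lebesgue_measure_itv/= !lte_fin ltr_pM2l ?invr_gt0// ltrD2r.
case: ifPn => _; rewrite ?mule0// -!EFinD -EFinM; congr _%:E.
by field; rewrite gt_eqF.
Qed.

Lemma integral_lebesgue_measure_affine (a b : R) (h : measurableTypeR R -> \bar R) :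
  (0 < a)%R -> measurable_fun setT h -> (forall t, 0 <= h t) ->
  \int[lebesgue_measure]_t h (a * t + b)%R = a^-1%:E * \int[lebesgue_measure]_t h t.
Proof.
move=> a0 mh h0.
have mf : measurable_fun setT (fun t : measurableTypeR R => (a * t + b)%R : measurableTypeR R).
  by apply: measurable_funD => //; exact: measurable_funM.
have e := @ge0_integral_pushforward _ _ _ _ _ _ mf lebesgue_measure setT h measurableT mh (fun y _ => h0 y).
rewrite preimage_setT in e; rewrite -[LHS]e.
have a0' : (0 <= a^-1)%R by rewrite invr_ge0 ltW.
rewrite -(@ge0_integral_mscale _ _ _ lebesgue_measure _ _ (NngNum a0'))//.
apply: (@eq_measure_integral _ _ _ _ (mscale (NngNum a0') lebesgue_measure)
  (image_measure lebesgue_measure mf)) => A mA _.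
exact: lebesgue_measure_affine.
Qed.

(** Tonelli for the last step of the iterated construction of [lebesgue]; it
    drives the inductions on the dimension below. *)
Lemma integral_lebesgueS n (h : borel 'rV[R]_n.+1 -> \bar R) :
  measurable_fun setT h -> (forall x, 0 <= h x) ->
  \int[lebesgue n.+1]_x h x =
  \int[lebesgue_measure]_t \int[lebesgue n]_v h (cons_row (t, v)).
Proof.
move=> mh h0.
have mc := @measurable_cons_row R n.
have e := @ge0_integral_pushforward _ _ _ _ _ _ mc (lebesgue_measure \x lebesgue n) setT h measurableT mh (fun y _ => h0 y).
rewrite preimage_setT in e; rewrite [LHS]e fubini_tonelli1//=.
exact: measurableT_comp.
Qed.

Lemma affine_cons_row n (a t b : R) (v c : 'rV[R]_n) :
  (a *: (cons_row (t, v) : 'rV[R]_n.+1) + cons_row (b, c))%R =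
  cons_row ((a * t + b)%R, (a *: v + c)%R).
Proof.
rewrite /cons_row /=; apply/matrixP => i j; rewrite !mxE.
by case: splitP => k _; rewrite !mxE.
Qed.

Lemma cons_row_surj n (b : 'rV[R]_n.+1) :
  exists c : measurableTypeR R * borel 'rV[R]_n, b = cons_row c.
Proof.
exists (lsubmx (b : 'rV[R]_(1 + n)) ord0 ord0, rsubmx (b : 'rV[R]_(1 + n))).
rewrite /cons_row /= -[LHS](@hsubmxK _ _ 1%N n b).
apply: (f_equal2 (@row_mx R 1 1 n)) => //.
by apply/matrixP => i j; rewrite !ord1 !mxE.
Qed.

Lemma integral_lebesgue_affine n (a : R) (b : 'rV[R]_n) (h : borel 'rV[R]_n -> \bar R) :
  (0 < a)%R -> measurable_fun setT h -> (forall t, 0 <= h t) ->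
  \int[lebesgue n]_x h (a *: (x : 'rV[R]_n) + b)%R =
    (a ^- n)%:E * \int[lebesgue n]_x h x.
Proof.
move=> a0; elim: n b h => [|n IH] b h mh h0.
  rewrite expr0 invr1 mul1e.
  by apply: eq_integral => x _; congr h; rewrite [LHS]thinmx0 [RHS]thinmx0.
have mha : measurable_fun setT (fun x : borel 'rV[R]_n.+1 => h (a *: (x : 'rV[R]_n.+1) + b)%R).
  by apply: (measurableT_comp mh); exact: measurable_affine.
have mhc : measurable_fun setT (h \o @cons_row R n).
  by apply: (measurableT_comp mh); exact: measurable_cons_row.
have [[b1 c] bE] := cons_row_surj b.
rewrite [LHS]integral_lebesgueS// (integral_lebesgueS mh h0).
transitivity (\int[lebesgue_measure]_t ((a ^- n)%:E *
    \int[lebesgue n]_v h (cons_row ((a * t + b1)%R, v)))).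
  apply: eq_integral => t _.
  rewrite -(IH c (fun v => h (cons_row ((a * t + b1)%R, v))))//; last first.
    exact: (measurableT_comp mhc (pair1_measurable _)).
  by apply: eq_integral => v _; congr h; rewrite bE [RHS](esym (affine_cons_row _ _ _ _ _)).
have mG := measurable_fun_fubini_tonelli_F (m2 := lebesgue n) _ mhc (fun x => h0 _).
pose G t := \int[lebesgue n]_v h (cons_row (t, v)).
have G0 t : 0 <= G t by exact: integral_ge0.
have maf : measurable_fun setT (fun t : measurableTypeR R => (a * t + b1)%R : measurableTypeR R).
  by apply: measurable_funD => //; exact: measurable_funM.
have an0 : (0 <= a ^- n)%R by rewrite invr_ge0 exprn_ge0// ltW.
rewrite (@ge0_integralZl_EFin _ _ _ lebesgue_measure setT measurableT
  (fun t => G (a * t + b1)%R) (fun t _ => G0 _) (measurableT_comp mG maf) _ an0).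
rewrite (@integral_lebesgue_measure_affine a b1 G)//.
by rewrite muleA -EFinM exprS invfM mulrC.
Qed.

End lebesgue_row.

Section lebesgue_cubes.
Context {R : realType}.
Local Open Scope ereal_scope.

Lemma lebesgue_affine n (a : R) (b : 'rV[R]_n) (A : set (borel 'rV[R]_n)) :
  (0 < a)%R -> measurable A ->
  lebesgue n [set x : borel 'rV[R]_n | A (a *: (x : 'rV[R]_n) + b)%R] =
  (a ^- n)%:E * lebesgue n A.
Proof.
move=> a0 mA.
have mA' : measurable [set x : borel 'rV[R]_n | A (a *: (x : 'rV[R]_n) + b)%R].
  by rewrite -[X in measurable X]setTI; exact: measurable_affine.
rewrite -[in RHS](setIT A) -(integral_indic _ measurableT mA).
rewrite -(@integral_lebesgue_affine _ n a b (fun x => (\1_A x)%:E))//; last first.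
  by apply/measurable_EFinP; exact: measurable_indic.
by rewrite -[in LHS](setIT [set x | _]) -(integral_indic _ measurableT mA').
Qed.

Definition cube n (s : R) : set 'rV[R]_n := [set x | forall i, (`|x ord0 i| <= s)%R].
Arguments cube : clear implicits.

Lemma measurable_cube n s : measurable (cube n s : set (borel 'rV[R]_n)).
Proof.
have -> : cube n s = \bigcap_(i in [set: 'I_n])
    ((fun x : borel 'rV[R]_n => (x : 'rV[R]_n) ord0 i : measurableTypeR R) @^-1` `[(- s)%R, s]%classic).
  by apply/seteqP; split=> x /= h i; [move=> _|]; move: (h i); rewrite /= in_itv /= ler_norml//; apply.
apply: fin_bigcap_measurable => [|i _]; first exact: finite_finset.
by rewrite -[X in measurable X]setTI; exact: measurable_coord.
Qed.

(** The balls of the sup norm are cubes, so this computes their measure; finiteness on bounded sets and positivity on neighbourhoods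
    follow by comparison. *)
Lemma lebesgue_cube n (s : R) : (0 <= s)%R -> lebesgue n (cube n s) = ((s *+ 2) ^+ n)%:E.
Proof.
move=> s0; elim: n => [|n IH].
  rewrite expr0 /= diracE mem_set//; first by case.
have mc := @measurable_cube n.+1 s.
rewrite -[X in lebesgue _ X](setIT _) -(integral_indic _ measurableT mc).
rewrite integral_lebesgueS; last 2 first.
- by apply/measurable_EFinP; exact: measurable_indic.
- by move=> x; rewrite lee_fin.
transitivity (\int[lebesgue_measure]_t (((s *+ 2) ^+ n)%:E * (\1_`[(-s)%R, s] t)%:E)).
  apply: eq_integral => t _; rewrite -IH muleC.
  rewrite -[X in lebesgue _ X](setIT _) -(integral_indic _ measurableT (@measurable_cube n s)).
  rewrite -ge0_integralZl_EFin//; last first.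
    by apply/measurable_EFinP; exact: measurable_indic (@measurable_cube n s).
  apply: eq_integral => v _; rewrite -EFinM; congr _%:E.
  rewrite !indicE -natrM mulnb; congr (nat_of_bool _)%:R.
  apply/idP/andP => [/set_mem h|[/set_mem h1 /set_mem h2]].
    split; [apply/mem_set|apply/mem_set => i].
      have := h ord0; rewrite /= in_itv/= -ler_norml.
      by rewrite /cons_row /= mxE; case: splitP => // j _; rewrite mxE.
    by have := h (rshift 1 i); rewrite [X in `|X|%R](@row_mxEr _ 1 1 n).
  apply/mem_set => i; rewrite /cons_row /= mxE; case: splitP => j _.
    by move: h1; rewrite mxE /= in_itv/= -ler_norml.
  exact: h2.
rewrite ge0_integralZl_EFin//; last first.
- by rewrite exprn_ge0// mulrn_wge0.
- by apply/measurable_EFinP; exact: measurable_indic.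
rewrite integral_indic// setIT /= lebesgue_measure_itv/= lte_fin.
case: ifPn => [_|]; first by rewrite -EFinD opprK -EFinM exprSr mulr2n.
rewrite -leNgt => ss; have -> : s = 0%R by lra.
by rewrite mul0rn mule0 exprS mul0r.
Qed.

Lemma norm_le_cube n (x : 'rV[R]_n) (s : R) : (0 <= s)%R ->
  (`|x| <= s)%R <-> cube n s x.
Proof.
move=> s0; rewrite /Num.norm /= mx_normrE; split=> [h i|h].
  exact: le_trans (le_bigmax_cond _ (fun ij : 'I_1 * 'I_n => `|x ij.1 ij.2|%R) (j := (ord0, i)) erefl) h.
by apply/bigmax_leP; split => // -[i j] _ /=; rewrite (ord1 i).
Qed.

Lemma lebesgue_bounded n (A : set (borel 'rV[R]_n)) :
  measurable A -> bounded_set (A : set 'rV[R]_n) -> lebesgue n A < +oo.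
Proof.
move=> mA [M [_ AM]].
apply: le_lt_trans (_ : lebesgue n (cube n `|M + 1|%R) < +oo); last by rewrite lebesgue_cube// ltry.
apply: le_measure; rewrite ?inE//; first exact: measurable_cube.
by move=> x Ax; apply/norm_le_cube => //; apply: le_trans (ler_norm (M + 1)%R); apply: AM => //; rewrite ltrDl.
Qed.

Lemma lebesgue_nbhs n (A : set (borel 'rV[R]_n)) (x : 'rV[R]_n) :
  measurable A -> nbhs x (A : set 'rV[R]_n) -> 0 < lebesgue n A.
Proof.
move=> mA /nbhs_ballP[e/= e0 xA].
pose s := (e / 2)%R; have s0 : (0 < s)%R by rewrite divr_gt0.
have mB : measurable [set y : borel 'rV[R]_n | cube n s (1 *: (y : 'rV[R]_n) + - x)%R].
  rewrite -[X in measurable X]setTI; apply: measurable_affine => //.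
  exact: measurable_cube.
apply: lt_le_trans (_ : lebesgue n _ <= _); last first.
  apply: (@le_measure _ _ _ _ [set y : borel 'rV[R]_n | cube n s (1 *: (y : 'rV[R]_n) + - x)%R]); rewrite ?inE//.
  move=> y /= ys; apply: xA; rewrite -ball_normE /ball_ /= distrC.
  have /norm_le_cube := ys; rewrite scale1r => /(_ (ltW s0))/le_lt_trans; apply.
  by rewrite /s ltr_pdivrMr// mulr2n mulrDr mulr1 ltrDl.
rewrite lebesgue_affine//; last exact: measurable_cube.
by rewrite lebesgue_cube ?ltW// expr1n invr1 mul1e lte_fin exprn_gt0// mulrn_wgt0.
Qed.

Lemma measurable_origin n : measurable ([set (0%R : 'rV[R]_n)] : set (borel 'rV[R]_n)).
Proof.
have -> : [set (0%R : 'rV[R]_n)] = cube n 0.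
  apply/seteqP; split=> [x ->|x h]; first by move=> i; rewrite mxE normr0.
  by apply/rowP => i; rewrite mxE; apply/eqP; rewrite -normr_le0; exact: h.
exact: measurable_cube.
Qed.

(** The origin is invariant under dilation by 2, which multiplies the measure by
    [2 ^- n] with [0 < n]. *)
Lemma lebesgue_origin n : (0 < n)%N -> lebesgue n [set (0%R : 'rV[R]_n)] = 0.
Proof.
move=> n0.
have m0 := @measurable_origin n.
have := @lebesgue_affine n 2%R 0%R _ (ltr0Sn _ 1) m0.
have -> : [set x : borel 'rV[R]_n | [set (0%R : 'rV[R]_n)] (2 *: (x : 'rV[R]_n) + 0)%R] = [set (0%R : 'rV[R]_n)].
  apply/seteqP; split => x /=; rewrite addr0; last by move=> ->; rewrite scaler0.
  by move/eqP; rewrite scaler_eq0 pnatr_eq0/= => /eqP.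
have fin : lebesgue n [set (0%R : 'rV[R]_n)] \is a fin_num.
  rewrite ge0_fin_numE// lebesgue_bounded//.
  by exists 0%R; split => // M M0 x /= ->; rewrite normr0 ltW.
rewrite -(fineK fin) -EFinM => -[] h; congr _%:E.
move/eqP: h; rewrite -subr_eq0 -{1}[fine _]mul1r -mulrBl mulf_eq0 => /orP[|/eqP//].
rewrite subr_eq0 eq_sym invr_eq1 => /eqP h; exfalso.
have : (1 < 2 ^+ n :> R)%R by rewrite exprn_egt1 ?ltr1n// -lt0n.
by rewrite h ltxx.
Qed.

Lemma measurable_mulmx m n (A : 'M[R]_(m, n)) :
  measurable_fun setT (fun u : borel 'rV[R]_m => (u : 'rV[R]_m) *m A : borel 'rV[R]_n).
Proof.
apply: measurable_row => j.
rewrite [X in measurable_fun _ X](_ : _ = fun u : borel 'rV[R]_m =>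
  \sum_i ((u : 'rV[R]_m) ord0 i * A i j)%R)%R; last first.
  by apply/funext => u; rewrite mxE.
by apply: measurable_sum => i; apply: measurable_funM => //; exact: measurable_coord.
Qed.

End lebesgue_cubes.
Arguments cube {R} n s _.

(** * Euclidean norm and orthogonal invariance of Lebesgue measure *)

Section euclid.
Context {R : realType}.

Lemma enorm_ge0 n (x : 'rV[R]_n) : 0 <= enorm x.
Proof. exact: sqrtr_ge0. Qed.

Lemma sqr_enorm n (x : 'rV[R]_n) : enorm x ^+ 2 = \sum_i x ord0 i ^+ 2.
Proof. by rewrite sqr_sqrtr// sumr_ge0// => i _; exact: sqr_ge0. Qed.

Lemma enormZ n (a : R) (x : 'rV[R]_n) : enorm (a *: x) = `|a| * enorm x.
Proof.
rewrite -sqrtr_sqr -sqrtrM ?sqr_ge0// mulr_sumr; congr Num.sqrt.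
by apply: eq_bigr => i _; rewrite mxE exprMn.
Qed.

Lemma enorm0 n : enorm (0 : 'rV[R]_n) = 0.
Proof. by rewrite -[0 in LHS](scale0r 0) enormZ normr0 mul0r. Qed.

Lemma enormN n (x : 'rV[R]_n) : enorm (- x) = enorm x.
Proof. by rewrite -scaleN1r enormZ normrN1 mul1r. Qed.

Lemma coord_le_enorm n (x : 'rV[R]_n) i : `|x ord0 i| <= enorm x.
Proof.
rewrite -sqrtr_sqr ler_sqrt; last by rewrite sumr_ge0// => j _; exact: sqr_ge0.
by rewrite (bigD1 i)//= lerDl sumr_ge0// => j _; exact: sqr_ge0.
Qed.

Lemma norm_le_enorm n (x : 'rV[R]_n) : `|x| <= enorm x.
Proof. by apply/norm_le_cube => [|i]; [exact: enorm_ge0|exact: coord_le_enorm]. Qed.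

Lemma enorm_eq0 n (x : 'rV[R]_n) : (enorm x == 0) = (x == 0).
Proof.
apply/idP/idP => [/eqP h|/eqP ->]; last by rewrite enorm0.
by rewrite -normr_le0 -h norm_le_enorm.
Qed.

Lemma enorm_gt0 n (x : 'rV[R]_n) : (0 < enorm x) = (x != 0).
Proof. by rewrite lt_neqAle enorm_ge0 andbT eq_sym enorm_eq0. Qed.

Lemma cvg_sumr (T I : Type) (F : set_system T) {FF : Filter F} (r : seq I)
    (f : I -> T -> R) (l : I -> R) :
  (forall i, f i x @[x --> F] --> l i) ->
  \sum_(i <- r) f i x @[x --> F] --> \sum_(i <- r) l i.
Proof.
move=> fl; elim: r => [|i r IH].
  by rewrite big_nil; under eq_cvg do rewrite big_nil; exact: cvg_cst.
by rewrite big_cons; under eq_cvg do rewrite big_cons; exact: cvgD.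
Qed.

Lemma enorm_continuous n : continuous (@enorm R n).
Proof.
move=> x; apply: continuous_comp; last exact: sqrt_continuous.
by apply: (@cvg_sumr _ _ (nbhs x) _) => i; apply: cvgM; exact: coord_continuous.
Qed.

Lemma sqr_enorm_mx n (x : 'rV[R]_n) : (enorm x ^+ 2)%:M = x *m x^T :> 'M[R]_1.
Proof.
apply/matrixP => i j; rewrite !ord1 !mxE eqxx mulr1n sqr_enorm.
by apply: eq_bigr => k _; rewrite mxE expr2.
Qed.

Lemma enorm_isometry m n (A : 'M[R]_(m, n)) (u : 'rV[R]_m) :
  A *m A^T = 1%:M -> enorm (u *m A) = enorm u.
Proof.
move=> A1; apply/eqP; rewrite -(eqrXn2 (n := 2))// ?enorm_ge0//; apply/eqP.
have := sqr_enorm_mx (u *m A).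
rewrite trmx_mul -mulmxA (mulmxA A) A1 mul1mx -sqr_enorm_mx => /matrixP/(_ ord0 ord0).
by rewrite !mxE eqxx !mulr1n.
Qed.

Lemma bounded_unit_ball n : bounded_set (@unit_ball R n).
Proof.
exists 1; split => // M M1 x /= x1.
by apply: le_trans (norm_le_enorm x) _; exact: le_trans x1 (ltW M1).
Qed.

Lemma nbhs_unit_ball n : nbhs (0 : 'rV[R]_n) (unit_ball n).
Proof.
have h : nbhs (enorm (0 : 'rV[R]_n)) [set t : R | t <= 1].
  rewrite enorm0; apply/nbhs_ballP; exists 1 => //= y; rewrite /ball/= sub0r normrN.
  by move=> h; apply/ltW/(le_lt_trans (ler_norm y)).
exact: (@enorm_continuous n 0 _ h).
Qed.

Lemma lebesgue_unit_ball_gt0 n : (0 < lebesgue n (@unit_ball R n))%E.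
Proof. exact (@lebesgue_nbhs R n _ _ (@measurable_unit_ball R n) (@nbhs_unit_ball n)). Qed.

Lemma lebesgue_unit_ball_lty n : (lebesgue n (@unit_ball R n) < +oo)%E.
Proof. exact: lebesgue_bounded (@measurable_unit_ball R n) (@bounded_unit_ball n). Qed.

Lemma lebesgue_unit_ball n : lebesgue n (@unit_ball R n) = (omega R n)%:E.
Proof. by rewrite /omega /vol fineK// ge0_fin_numE// lebesgue_unit_ball_lty. Qed.

Lemma omega_gt0 n : 0 < omega R n.
Proof. by rewrite -lte_fin -lebesgue_unit_ball lebesgue_unit_ball_gt0. Qed.

Lemma normalize_enorm n (x : 'rV[R]_n) : x != 0 -> enorm (normalize x : 'rV[R]_n) = 1.
Proof.
move=> x0; rewrite /normalize enormZ ger0_norm ?invr_ge0 ?enorm_ge0//.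
by rewrite mulVf// enorm_eq0.
Qed.

Local Open Scope ereal_scope.

Lemma measurable_rowD d (T : measurableType d) n (f g : T -> borel 'rV[R]_n) :
  measurable_fun setT f -> measurable_fun setT g ->
  measurable_fun setT (fun t => ((f t : 'rV[R]_n) + g t)%R : borel 'rV[R]_n).
Proof.
move=> mf mg; apply: measurable_row => i.
rewrite [X in measurable_fun _ X](_ : _ = fun t =>
  ((f t : 'rV[R]_n) ord0 i + (g t : 'rV[R]_n) ord0 i)%R); last first.
  by apply/funext => p; rewrite mxE.
by apply: measurable_funD; apply: (measurableT_comp (measurable_coord i)).
Qed.

(** The uniqueness argument for Haar measure.  The left-hand side is the
    integral of [F x * G (x + y Q)] over all pairs [(x, y)], since the inner
    integral does not see the translation by [x]; translating [x] by [- y Q]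
    turns it into the integral of [F (x - y Q) * G x]. *)
Lemma integral_lebesgue_orthogonal_exchange n (Q : 'M[R]_n) (F G : borel 'rV[R]_n -> \bar R) :
  (Q *m Q^T = 1%:M)%R ->
  measurable_fun setT F -> measurable_fun setT G ->
  (forall x, 0 <= F x) -> (forall x, 0 <= G x) ->
  \int[lebesgue n]_x F x * \int[lebesgue n]_y G ((y : 'rV[R]_n) *m Q)%R =
  \int[lebesgue n]_x G x * \int[lebesgue n]_y F (- ((y : 'rV[R]_n) *m Q))%R.
Proof.
move=> Q1 mF mG F0 G0.
have mQ : measurable_fun setT (fun y : borel 'rV[R]_n => (y : 'rV[R]_n) *m Q : borel 'rV[R]_n).
  exact: measurable_mulmx.
have mNQ : measurable_fun setT (fun y : borel 'rV[R]_n => (- ((y : 'rV[R]_n) *m Q))%R : borel 'rV[R]_n).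
  rewrite [X in measurable_fun _ X](_ : _ = fun y : borel 'rV[R]_n => (y : 'rV[R]_n) *m (- Q)); last first.
    by apply/funext => y; rewrite mulmxN.
  exact: measurable_mulmx.
have tr (h : borel 'rV[R]_n -> \bar R) (b : 'rV[R]_n) :
    measurable_fun setT h -> (forall x, 0 <= h x) ->
    \int[lebesgue n]_x h ((x : 'rV[R]_n) + b)%R = \int[lebesgue n]_x h x.
  move=> mh h0; have := @integral_lebesgue_affine R n 1%R b h ltr01 mh h0.
  rewrite expr1n invr1 mul1e => <-.
  by apply: eq_integral => x _; rewrite scale1r.
have mGQ : measurable_fun setT (fun y : borel 'rV[R]_n => G ((y : 'rV[R]_n) *m Q)).
  exact: measurableT_comp mG mQ.
have mFQ : measurable_fun setT (fun y : borel 'rV[R]_n => F (- ((y : 'rV[R]_n) *m Q))%R).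
  exact: measurableT_comp mF mNQ.
have J0 (h : borel 'rV[R]_n -> \bar R) : (forall x, 0 <= h x) -> 0 <= \int[lebesgue n]_y h y.
  by move=> h0; exact: integral_ge0.
rewrite -(@ge0_integralZr _ _ _ (lebesgue n) setT measurableT _ mF _ (fun x _ => F0 x)); last exact: J0.
rewrite -(@ge0_integralZr _ _ _ (lebesgue n) setT measurableT _ mG _ (fun x _ => G0 x)); last exact: J0.
transitivity (\int[lebesgue n]_x \int[lebesgue n]_y (F x * G ((y : 'rV[R]_n) *m Q + x)%R)).
  apply: eq_integral => x _.
  have mGx : measurable_fun setT (fun y : borel 'rV[R]_n => G ((y : 'rV[R]_n) *m Q + x)%R).
    rewrite [X in measurable_fun _ X](_ : _ = G \o (fun y : borel 'rV[R]_n => (1 *: (y : 'rV[R]_n) + x)%R) \o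
      (fun y : borel 'rV[R]_n => (y : 'rV[R]_n) *m Q : borel 'rV[R]_n)); last first.
      by apply/funext => y /=; rewrite scale1r.
    by do 2 apply: measurableT_comp => //; exact: measurable_affine.
  rewrite ge0_integralZl//; congr (_ * _).
  rewrite -(tr (fun y : borel 'rV[R]_n => G ((y : 'rV[R]_n) *m Q)%R) (x *m Q^T))//.
  apply: eq_integral => y _; congr G.
  by rewrite mulmxDl -mulmxA (mulmx1C Q1) mulmx1.
transitivity (\int[lebesgue n]_x \int[lebesgue n]_y (G x * F (- ((y : 'rV[R]_n) *m Q) + x)%R)).
  have mFG : measurable_fun setT (fun p : borel 'rV[R]_n * borel 'rV[R]_n =>
     F p.1 * G ((p.2 : 'rV[R]_n) *m Q + p.1)%R).
    apply: emeasurable_funM; first exact: measurableT_comp mF measurable_fst.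
    apply: (measurableT_comp mG).
    apply: measurable_rowD; last exact: measurable_fst.
    exact: measurableT_comp mQ measurable_snd.
  rewrite (fubini_tonelli _ mFG)/=; last by move=> x; rewrite mule_ge0.
  have mGF : measurable_fun setT (fun p : borel 'rV[R]_n * borel 'rV[R]_n =>
     G p.1 * F (- ((p.2 : 'rV[R]_n) *m Q) + p.1)%R).
    apply: emeasurable_funM; first exact: measurableT_comp mG measurable_fst.
    apply: (measurableT_comp mF).
    apply: measurable_rowD; last exact: measurable_fst.
    exact: measurableT_comp mNQ measurable_snd.
  rewrite [RHS](fubini_tonelli _ mGF)/=; last by move=> x; rewrite mule_ge0.
  apply: eq_integral => y _.
  rewrite -(tr (fun x => F x * G ((y : 'rV[R]_n) *m Q + x)%R) (- ((y : 'rV[R]_n) *m Q))%R)//; last 2 first.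
  - exact: (measurableT_comp mFG (pair2_measurable y)).
  - by move=> x; rewrite mule_ge0.
  by apply: eq_integral => x _; rewrite muleC addrCA subrr addr0 addrC.
apply: eq_integral => x _.
have mFx : measurable_fun setT (fun y : borel 'rV[R]_n => F (- ((y : 'rV[R]_n) *m Q) + x)%R).
  rewrite [X in measurable_fun _ X](_ : _ = F \o (fun y : borel 'rV[R]_n => (1 *: (y : 'rV[R]_n) + x)%R) \o
    (fun y : borel 'rV[R]_n => (- ((y : 'rV[R]_n) *m Q))%R : borel 'rV[R]_n)); last first.
    by apply/funext => y /=; rewrite scale1r.
  by do 2 apply: measurableT_comp => //; exact: measurable_affine.
rewrite ge0_integralZl//; congr (_ * _).
rewrite -(tr (fun y : borel 'rV[R]_n => F (- ((y : 'rV[R]_n) *m Q))%R) (- (x *m Q^T))%R)//.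
apply: eq_integral => y _; congr F.
by rewrite mulmxDl mulNmx -mulmxA (mulmx1C Q1) mulmx1 opprD opprK.
Qed.

(** In the exchange formula take for [F] the indicator function of the Euclidean
    ball: it is even and unchanged by [Q], so both sides carry the same positive
    finite factor [omega R n]. *)
Lemma integral_lebesgue_orthogonal n (Q : 'M[R]_n) (G : borel 'rV[R]_n -> \bar R) :
  (Q *m Q^T = 1%:M)%R -> measurable_fun setT G -> (forall x, 0 <= G x) ->
  \int[lebesgue n]_y G ((y : 'rV[R]_n) *m Q)%R = \int[lebesgue n]_x G x.
Proof.
move=> Q1 mG G0.
pose F (x : borel 'rV[R]_n) := (\1_(unit_ball n) (x : 'rV[R]_n) : R)%:E.
have mF : measurable_fun setT F.
  by apply/measurable_EFinP; exact: measurable_indic (@measurable_unit_ball R n).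
have F0 x : 0 <= F x by rewrite lee_fin.
have FQ x : F (- ((x : 'rV[R]_n) *m Q))%R = F x.
  congr (_%:E); rewrite !indicE; congr ((nat_of_bool _)%:R)%R.
  by apply/idP/idP => /set_mem h; apply/mem_set; move: h;
    rewrite /unit_ball /= enormN enorm_isometry.
have := integral_lebesgue_orthogonal_exchange Q1 mF mG F0 G0.
under [X in _ = _ * X]eq_integral do rewrite FQ.
have -> : \int[lebesgue n]_x F x = (omega R n)%:E.
  by rewrite (integral_indic _ measurableT (@measurable_unit_ball R n)) setIT; exact: lebesgue_unit_ball.
rewrite muleC => h.
have w0 := omega_gt0 n.
have := congr1 (fun z => z * ((omega R n)^-1)%:E) h.
by rewrite /= -!muleA -!EFinM mulfV ?gt_eqF// !mule1.
Qed.

End euclid.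

(** * Integration in polar coordinates *)

Section polar.
Context {R : realType}.
Local Open Scope ereal_scope.

Lemma integral_image_measure d1 d2 (T1 : measurableType d1) (T2 : measurableType d2)
    (mu : {measure set T1 -> \bar R}) (f : T1 -> T2) (mf : measurable_fun setT f)
    (D : set T2) (h : T2 -> \bar R) :
  measurable D -> measurable_fun D h -> (forall y, 0 <= h y) ->
  \int[image_measure mu mf]_(y in D) h y = \int[mu]_(x in f @^-1` D) h (f x).
Proof. by move=> mD mh h0; exact: (ge0_integral_pushforward mf mu mD mh). Qed.

Lemma integral_mrestr d (T : measurableType d) (mu : {measure set T -> \bar R})
    (B D : set T) (mB : measurable B) (h : T -> \bar R) :
  measurable D -> measurable_fun D h -> (forall y, 0 <= h y) ->
  \int[mrestr mu mB]_(y in D) h y = \int[mu]_(y in D `&` B) h y.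
Proof.
move=> mD mh h0.
rewrite (@ge0_negligible_integral _ _ _ (mrestr mu mB) D (~` B))//; last 2 first.
- exact: measurableC.
- by transitivity (mu (~` B `&` B)) => //; rewrite setICl measure0.
rewrite setDE setCK; apply: eq_measure_integral => A mA ADB.
by transitivity (mu (A `&` B)) => //; rewrite setIidl// => x /ADB[].
Qed.

Lemma measurable_unit_sphere n : measurable (@unit_sphere R n : set (borel 'rV[R]_n)).
Proof.
have -> : @unit_sphere R n = setT `&` @enorm R n @^-1` [set 1%R].
  by rewrite setTI.
by apply: measurable_enorm.
Qed.

Definition punctured_ball n (x : borel 'rV[R]_n) : R :=
  \1_(unit_ball n `&` [set x : 'rV[R]_n | x != 0%R]) x.

Lemma measurable_punctured n :
  measurable (@unit_ball R n `&` [set x : 'rV[R]_n | x != 0%R] : set (borel 'rV[R]_n)).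
Proof.
apply: measurableI; first exact: (@measurable_unit_ball R n).
have -> : [set x : 'rV[R]_n | x != 0%R] = setT `&` @enorm R n @^-1` (~` [set 0%R]).
  by rewrite setTI; apply/seteqP; split => x /=; rewrite -enorm_eq0 => /eqP.
apply: measurable_enorm => //; exact: measurableC.
Qed.

(** The sphere measure lives on directions of points of the ball; the origin has
    no direction, hence the punctured ball. *)
Lemma integral_sphere n (g : borel 'rV[R]_n -> \bar R) :
  measurable_fun setT g -> (forall x, 0 <= g x) ->
  \int[sphere_measure n]_(x in unit_sphere n) g x =
  n%:R%:E * \int[lebesgue n]_x ((punctured_ball x)%:E * g (normalize x)).
Proof.
move=> mg g0.
have mS := @measurable_unit_sphere n.
have mgS : measurable_fun (unit_sphere n : set (borel 'rV[R]_n)) g by exact: measurable_funTS.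
have mN := @measurable_normalize R n.
have mgN : measurable_fun setT (fun x : borel 'rV[R]_n => g (normalize x)).
  exact: measurableT_comp mg mN.
rewrite [LHS](@ge0_integral_mscale _ _ _ (image_measure _ _) _ mS)//; congr (_ * _).
rewrite integral_image_measure//.
rewrite integral_mrestr//; last 2 first.
- by rewrite -[X in measurable X]setTI; exact: mN.
- exact: measurable_funTS.
have -> : @normalize R n @^-1` (unit_sphere n) `&` (unit_ball n) =
          unit_ball n `&` [set x : 'rV[R]_n | x != 0%R].
  apply/seteqP; split => x [h1 h2]; split => //; last exact: normalize_enorm.
  apply/eqP => x0; move: h1; rewrite /unit_sphere /= x0 /normalize scaler0 enorm0.
  by move/esym/eqP; rewrite oner_eq0.
rewrite integral_mkcond; apply: eq_integral => x _.
rewrite /patch /punctured_ball indicE; case: ifPn => _; first by rewrite mul1e.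
by rewrite mul0e.
Qed.

(** The density [r^(m-1)] on the positive half-line, extended by 0 so that
    integrals along rays become integrals over the whole line. *)
Definition ray_weight m (r : R) : R := if (0 < r)%R then (r ^+ m.-1)%R else 0%R.

Lemma measurable_ray_weight m : measurable_fun setT (ray_weight m : measurableTypeR R -> measurableTypeR R).
Proof.
rewrite [X in measurable_fun _ X](_ : _ = fun r => (\1_`]0%R, +oo[ r * r ^+ m.-1)%R); last first.
  apply/funext => r; rewrite /ray_weight indicE mem_setE in_itv/= andbT.
  by case: ifPn => _; rewrite ?mul1r ?mul0r.
by apply: measurable_funM => //; exact: measurable_indic.
Qed.

Lemma ray_weight_ge0 m r : (0 <= ray_weight m r)%R.
Proof. by rewrite /ray_weight; case: ifPn => // r0; rewrite exprn_ge0// ltW. Qed.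

Lemma ray_weightM m (s r : R) : (0 < s)%R ->
  ray_weight m (s * r)%R = (s ^+ m.-1 * ray_weight m r)%R.
Proof.
by move=> s0; rewrite /ray_weight pmulr_rgt0//; case: ifPn => _; rewrite ?mulr0// exprMn.
Qed.

(** The exponent [m] of the weight is kept apart from the dimension [d] of the
    space: a ray in R^n is integrated with weight [r^(n-1)] for the volume and
    with weight [r^(n-k-1)] for its contribution to a section. *)
Definition ray_integral d m (h : borel 'rV[R]_d -> \bar R) (x : borel 'rV[R]_d) : \bar R :=
  \int[lebesgue_measure]_r ((ray_weight m r)%:E * h (r *: (x : 'rV[R]_d))%R).

Lemma measurable_rowZ d (T : measurableType d) n (a : T -> measurableTypeR R) (f : T -> borel 'rV[R]_n) :
  measurable_fun setT a -> measurable_fun setT f ->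
  measurable_fun setT (fun t => (a t *: (f t : 'rV[R]_n))%R : borel 'rV[R]_n).
Proof.
move=> ma mf; apply: measurable_row => i.
rewrite [X in measurable_fun _ X](_ : _ = fun t => (a t * (f t : 'rV[R]_n) ord0 i)%R); last first.
  by apply/funext => p; rewrite mxE.
by apply: measurable_funM => //; exact: (measurableT_comp (measurable_coord i)).
Qed.

Lemma measurable_ray_integrand d m (h : borel 'rV[R]_d -> \bar R) : measurable_fun setT h ->
  measurable_fun setT (fun p : borel 'rV[R]_d * measurableTypeR R =>
    (ray_weight m p.2)%:E * h (p.2 *: (p.1 : 'rV[R]_d))%R).
Proof.
move=> mh; apply: emeasurable_funM.
  by apply/measurable_EFinP; exact: (measurableT_comp (@measurable_ray_weight m) measurable_snd).
by apply: (measurableT_comp mh); exact: measurable_rowZ measurable_snd measurable_fst.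
Qed.

Lemma ray_integrand_ge0 d m (h : borel 'rV[R]_d -> \bar R) r (x : 'rV[R]_d) :
  (forall x, 0 <= h x) -> 0 <= (ray_weight m r)%:E * h (r *: x)%R.
Proof. by move=> h0; rewrite mule_ge0// lee_fin ray_weight_ge0. Qed.

Lemma measurable_ray_integral d m (h : borel 'rV[R]_d -> \bar R) :
  measurable_fun setT h -> (forall x, 0 <= h x) ->
  measurable_fun setT (ray_integral m h).
Proof.
move=> mh h0.
exact: (measurable_fun_fubini_tonelli_F _ (measurable_ray_integrand m mh) (fun p => ray_integrand_ge0 _ _ _ h0)).
Qed.

Lemma ray_integral_ge0 d m (h : borel 'rV[R]_d -> \bar R) x :
  (forall x, 0 <= h x) -> 0 <= ray_integral m h x.
Proof. by move=> h0; apply: integral_ge0 => r _; exact: ray_integrand_ge0. Qed.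

Lemma ray_integralZ d m (h : borel 'rV[R]_d -> \bar R) (s : R) (x : 'rV[R]_d) :
  (0 < m)%N -> measurable_fun setT h -> (forall x, 0 <= h x) -> (0 < s)%R ->
  ray_integral m h (s *: x)%R = (s ^- m)%:E * ray_integral m h x.
Proof.
move=> m0 mh h0 s0; rewrite /ray_integral.
(* [psi] is the integrand at [x]; the integrand at [s x] is [s ^- m.-1 * psi (s r)]. *)
pose psi r := (ray_weight m r)%:E * h (r *: x)%R.
have psi0 r : 0 <= psi r by exact: ray_integrand_ge0.
have mpsi : measurable_fun setT (psi : measurableTypeR R -> _).
  exact: (measurableT_comp (measurable_ray_integrand m mh) (pair1_measurable (x : borel 'rV[R]_d))).
have mpsis : measurable_fun setT (fun r : measurableTypeR R => psi (s * r + 0)%R).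
  have maf : measurable_fun setT (fun t : measurableTypeR R => (s * t + 0)%R : measurableTypeR R).
    by apply: measurable_funD => //; exact: measurable_funM.
  exact: measurableT_comp mpsi maf.
have sm0 : (0 <= s ^- m.-1)%R by rewrite invr_ge0 exprn_ge0// ltW.
transitivity (\int[lebesgue_measure]_r ((s ^- m.-1)%:E * psi (s * r + 0)%R)).
  apply: eq_integral => r _; rewrite /psi addr0 ray_weightM// muleA -EFinM.
  by rewrite mulrA mulVf ?expf_neq0 ?gt_eqF// mul1r scalerA (mulrC s).
rewrite (@ge0_integralZl_EFin _ _ _ lebesgue_measure setT measurableT _ (fun r _ => psi0 _) mpsis _ sm0).
rewrite (@integral_lebesgue_measure_affine _ s 0%R psi)// muleA -EFinM.
by rewrite -invfM -exprSr prednK.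
Qed.

Lemma cvg_exprn (T : Type) (F : set_system T) {FF : Filter F} (f : T -> R) (l : R) m :
  f x @[x --> F] --> l -> (f x ^+ m)%R @[x --> F] --> (l ^+ m)%R.
Proof.
move=> fl; elim: m => [|m IH].
  by rewrite expr0; under eq_cvg do rewrite expr0; exact: cvg_cst.
by rewrite exprS; under eq_cvg do rewrite exprS; exact: cvgM.
Qed.

(** The antiderivative is [- a ^+ m * r ^- m]. *)
Lemma integral_inv_pow m (a : R) : (0 < m)%N -> (0 < a)%R ->
  \int[lebesgue_measure]_(r in `[a, +oo[) (m%:R * a ^+ m * r ^- m.+1)%:E = 1.
Proof.
move=> m0 a0.
pose F (r : R) : R := (- a ^+ m * (r^-1) ^+ m)%R.
have dF (x : R) : (0 < x)%R -> is_derive x 1%R F (m%:R * a ^+ m * x ^- m.+1)%R.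
  move=> x0; have xn0 : x != 0%R by rewrite gt_eqF.
  have dV : is_derive x 1%R (fun y : R => y^-1)%R (- x ^- 2)%R.
    apply: DeriveDef; first exact: derivableV.
    by rewrite deriveV// derive_id -[RHS]mulr1.
  have dX := is_deriveX m dV.
  have := is_deriveZ (- a ^+ m)%R dX.
  have -> : ((- a ^+ m) *: ((m%:R * (x^-1) ^+ m.-1) *: - x ^- 2) = m%:R * a ^+ m * x ^- m.+1 :> R)%R.
    have -> : (x ^- m.+1 = x^-1 ^+ m.-1 * x ^- 2)%R.
      by rewrite exprVn -invfM -exprD addn2 prednK.
    by rewrite /GRing.scale /=; ring.
  congr (is_derive _ _ _ _); apply/funext => y.
  by rewrite /F /= exprfctE.
have cV (x : R) : (0 < x)%R -> {for x, continuous (fun y : R => y^-1)%R}.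
  by move=> x0; apply: inv_continuous; rewrite gt_eqF.
have cF (x : R) : (0 < x)%R -> {for x, continuous F}.
  move=> x0; apply: cvgM; first exact: cvg_cst.
  by apply: (@cvg_exprn _ (nbhs x) _); exact: cV.
rewrite (@ge0_continuous_FTC2y _ _ F a 0%R).
- rewrite /F exprVn mulNr mulfV ?expf_neq0 ?gt_eqF//.
  by rewrite -EFinB opprK add0r.
- move=> x ax; rewrite mulr_ge0 ?mulr_ge0 ?invr_ge0 ?exprn_ge0//.
    exact: ltW.
  exact: le_trans (ltW a0) ax.
- apply: continuous_in_subspaceT => x; rewrite inE/= in_itv/= andbT => ax.
  apply: cvgM; first exact: cvg_cst.
  under eq_cvg do rewrite -exprVn; rewrite -exprVn.
  by apply: (@cvg_exprn _ (nbhs x) _); exact/cV/(lt_le_trans a0).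
- rewrite -[X in _ --> X](mulr0 (- a ^+ m)%R); apply: cvgM; first exact: cvg_cst.
  rewrite -[X in _ --> X](_ : 0 ^+ m = 0)%R; last by rewrite expr0n eqn0Ngt m0.
  apply: cvg_exprn; apply/gtr0_cvgV0; last exact: cvg_id.
  exact: nbhs_pinfty_gt.
- by move=> x ax; have [] := dF x (lt_trans a0 ax).
- by apply: cvg_at_right_filter; exact: cF.
- move=> x; rewrite in_itv/= andbT => ax; rewrite derive1E.
  by have [_ ->] := dF x (lt_trans a0 ax).
Qed.

End polar.

Section polar_formula.
Context {R : realType}.
Local Open Scope ereal_scope.

(** By homogeneity of [ray_integral n h], its value at the direction of [x] is
    [enorm x ^+ n] times its value at [x]; this weight therefore turns an
    integral over directions into an integral over the ball. *)
Definition cone_weight n (x : borel 'rV[R]_n) : R := (punctured_ball x * enorm x ^+ n)%R.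

Lemma measurable_cone_weight n : measurable_fun setT (@cone_weight n : _ -> measurableTypeR R).
Proof.
apply: measurable_funM; first exact: measurable_indic (@measurable_punctured R n).
by apply: measurable_funX; exact: measurable_enorm.
Qed.

Lemma cone_weight_ge0 n (x : borel 'rV[R]_n) : (0 <= cone_weight x)%R.
Proof. by rewrite mulr_ge0// exprn_ge0// enorm_ge0. Qed.

Lemma cone_weightE n (x : 'rV[R]_n) :
  cone_weight x = if (enorm x <= 1)%R && (x != 0%R) then (enorm x ^+ n)%R else 0%R.
Proof.
rewrite /cone_weight /punctured_ball indicE; case: ifPn => [/andP[x1 x0]|h].
  by rewrite mem_set// mul1r.
by rewrite memNset ?mul0r// => -[h1 h2]; move: h; rewrite h1 h2.
Qed.

(** The kernel left after substituting [y = r x] for fixed [r > 0] in the double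
    integral over the ball and the half-line.  For [y != 0] it equals
    [n * enorm y ^+ n * r ^- n.+1] if [enorm y <= r] and 0 otherwise. The powers
    with exponent [-1] are inverses for [r > 0]; for [r <= 0] the ray weight is
    0 anyway. *)
Definition shell_kernel n (r : R) (y : borel 'rV[R]_n) : R :=
  (n%:R * (ray_weight n r * ((r `^ (-1)) ^+ n * cone_weight (r `^ (-1) *: (y : 'rV[R]_n)))))%R.

Lemma shell_kernelE n (r : R) (y : 'rV[R]_n) : (0 < n)%N -> y != 0%R ->
  (shell_kernel r y)%:E =
  ((fun r => (n%:R * enorm y ^+ n * r ^- n.+1)%:E) \_ `[enorm y, +oo[) r.
Proof.
move=> n0 y0; rewrite /patch mem_setE in_itv/= andbT /shell_kernel /ray_weight.
have ey : (0 < enorm y)%R by rewrite enorm_gt0.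
case: (ltP 0%R r) => r0; last by rewrite leNgt (le_lt_trans r0 ey)/= mul0r mulr0.
rewrite (powR_inv1 (ltW r0)) cone_weightE enormZ ger0_norm; last by rewrite invr_ge0 ltW.
rewrite ler_pdivrMl// mulr1.
rewrite scaler_eq0 invr_eq0 gt_eqF//= y0 andbT.
case: ifPn => _; last by rewrite !mulr0.
congr _%:E; rewrite exprMn !exprVn.
have -> : (r ^- n.+1 = r ^+ n.-1 * (r ^- n * r ^- n))%R.
  rewrite -{1 3 4}(prednK n0) !exprS !invfM.
  by field; rewrite expf_neq0 gt_eqF.
by ring.
Qed.

Lemma shell_kernel_ge0 n (r : R) (y : borel 'rV[R]_n) : (0 <= shell_kernel r y)%R.
Proof.
apply: mulr_ge0 => //; apply: mulr_ge0; first exact: ray_weight_ge0.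
apply: mulr_ge0; last exact: cone_weight_ge0.
by rewrite exprn_ge0// powR_ge0.
Qed.

Lemma integral_shell_kernel n (y : 'rV[R]_n) : (0 < n)%N -> y != 0%R ->
  \int[lebesgue_measure]_r (shell_kernel r y)%:E = 1.
Proof.
move=> n0 y0; rewrite -(@integral_inv_pow R n (enorm y))//; last by rewrite enorm_gt0.
by rewrite [RHS]integral_mkcond; apply: eq_integral => r _; exact: shell_kernelE.
Qed.

Lemma measurable_shell_kernel n : measurable_fun setT
  (fun p : measurableTypeR R * borel 'rV[R]_n => shell_kernel p.1 p.2 : measurableTypeR R).
Proof.
have mI : measurable_fun setT (fun p : measurableTypeR R * borel 'rV[R]_n =>
    (p.1 `^ (-1))%R : measurableTypeR R).
  exact: (measurableT_comp (measurable_powR (-1)%R) measurable_fst).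
apply: measurable_funM => //; apply: measurable_funM.
  exact: (measurableT_comp (@measurable_ray_weight R n) measurable_fst).
apply: measurable_funM; first exact: measurable_funX.
apply: (measurableT_comp (@measurable_cone_weight n)).
by apply: measurable_rowZ => //; exact: measurable_snd.
Qed.

(** Unfolding the sphere measure, the right-hand side is a double integral over
    [x] in the ball and [r > 0] of a weight times [h (r x)].  Substituting
    [y = r x] for fixed [r] and integrating in [r] first, the weight of [h y]
    becomes the integral of [shell_kernel], which is 1 for [y != 0]. *)
Lemma polar n (h : borel 'rV[R]_n -> \bar R) :
  (0 < n)%N -> measurable_fun setT h -> (forall x, 0 <= h x) ->
  \int[lebesgue n]_x h x =
  \int[sphere_measure n]_(x in unit_sphere n) ray_integral n h x.
Proof.
move=> n0 mh h0.
have mray := measurable_ray_integral n mh h0.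
have ray0 x := @ray_integral_ge0 R n n h x h0.
have mw : measurable_fun setT (fun x : borel 'rV[R]_n => (cone_weight x)%:E).
  by apply/measurable_EFinP; exact: measurable_cone_weight.
have wE0 (x : borel 'rV[R]_n) : 0 <= (cone_weight x)%:E by rewrite lee_fin cone_weight_ge0.
rewrite integral_sphere//.
pose f1 (p : borel 'rV[R]_n * measurableTypeR R) : \bar R :=
  (cone_weight p.1)%:E * ((ray_weight n p.2)%:E * h (p.2 *: (p.1 : 'rV[R]_n))%R).
have mf1 : measurable_fun setT f1.
  apply: emeasurable_funM; last exact: measurable_ray_integrand.
  exact: (measurableT_comp mw measurable_fst).
have f10 p : 0 <= f1 p by rewrite mule_ge0// ray_integrand_ge0.
transitivity (n%:R%:E * \int[lebesgue n]_x \int[lebesgue_measure]_r f1 (x, r)); last first.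
  congr (_ * _); apply: eq_integral => x _.
  rewrite /f1 /= ge0_integralZl_EFin ?cone_weight_ge0//; last 2 first.
  - by move=> r _; exact: ray_integrand_ge0.
  - exact: (measurableT_comp (measurable_ray_integrand n mh) (pair1_measurable x)).
  rewrite -/(ray_integral n h x) /cone_weight /normalize.
  have [->|x0] := eqVneq (x : 'rV[R]_n) 0%R.
    by rewrite /punctured_ball indicE memNset/= ?mul0r ?mul0e// => -[_]/=; rewrite eqxx.
  rewrite ray_integralZ ?invr_gt0 ?enorm_gt0//.
  by rewrite exprVn invrK muleA -EFinM.
rewrite (fubini_tonelli f1)//.
pose f2 (p : measurableTypeR R * borel 'rV[R]_n) : \bar R := (shell_kernel p.1 p.2)%:E * h p.2.
have f20 p : 0 <= f2 p by rewrite mule_ge0// lee_fin shell_kernel_ge0.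
have mk : measurable_fun setT (fun p : measurableTypeR R * borel 'rV[R]_n => (shell_kernel p.1 p.2)%:E).
  by apply/measurable_EFinP; exact: measurable_shell_kernel.
have mf2 : measurable_fun setT f2.
  apply: emeasurable_funM => //.
  exact: (measurableT_comp mh measurable_snd).
transitivity (\int[lebesgue_measure]_r \int[lebesgue n]_y f2 (r, y)).
  rewrite [RHS](fubini_tonelli f2)//.
  have mN0 := @measurable_origin R n.
  rewrite [LHS](ge0_negligible_integral mN0)//; last exact: lebesgue_origin.
  rewrite [RHS](ge0_negligible_integral mN0)//; last 3 first.
  - exact: (measurable_fun_fubini_tonelli_G f2).
  - by move=> y _; exact: integral_ge0.
  - exact: lebesgue_origin.
  apply: eq_integral => y; rewrite inE /= => -[_ y0].
  rewrite /f2/= ge0_integralZr//; last 2 first.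
  - exact: (measurableT_comp mk (pair2_measurable y)).
  - by move=> r _; rewrite lee_fin shell_kernel_ge0.
  by rewrite integral_shell_kernel ?mul1e//; exact/eqP.
rewrite -ge0_integralZl_EFin//; last 2 first.
- by move=> r _; exact: integral_ge0.
- exact: (measurable_fun_fubini_tonelli_G f1).
apply: eq_integral => r _.
rewrite -ge0_integralZl_EFin//; last first.
  exact: (measurableT_comp mf1 (pair2_measurable r)).
rewrite /f2 /f1 /=.
case: (ltP 0%R r) => r0; last first.
  transitivity (0 : \bar R); [|apply: esym]; apply: integral0_eq => x _;
    by rewrite /shell_kernel /ray_weight ltNge r0 /= ?mul0r ?mulr0 ?mul0e ?mule0.
(* The integrand after the substitution [y = r x]. *)
pose H (y : borel 'rV[R]_n) := (n%:R%:E * ((cone_weight (r^-1 *: (y : 'rV[R]_n)))%:E * ((ray_weight n r)%:E * h y))).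
have H0 y : 0 <= H y by rewrite !mule_ge0// lee_fin ?cone_weight_ge0 ?ray_weight_ge0.
have mH : measurable_fun setT H.
  apply: emeasurable_funM => //; apply: emeasurable_funM; last exact: emeasurable_funM.
  by apply: (measurableT_comp mw); exact: measurable_rowZ.
transitivity (\int[lebesgue n]_x H (r *: (x : 'rV[R]_n) + 0)%R); last first.
  apply: eq_integral => x _; rewrite /H addr0 scalerA mulVf ?gt_eqF// scale1r.
  by [].
rewrite (@integral_lebesgue_affine _ n r 0%R H)// -ge0_integralZl_EFin//; last first.
  by rewrite invr_ge0 exprn_ge0// ltW.
apply: eq_integral => y _.
rewrite /H /shell_kernel (powR_inv1 (ltW r0)) exprVn !muleA -!EFinM; congr (_%:E * _).
ring.
Qed.

End polar_formula.

(** * Star bodies and their gauges *)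

Notation gauge := Defs.minkowski.

Section star.
Context {R : realType} (n : nat).
Implicit Types (K : set 'rV[R]_n) (u x : 'rV[R]_n).

Lemma line_preimage_closed K u : closed K -> closed [set s : R | K (s *: u)].
Proof. by move=> cK; apply: (@closed_comp _ _ (fun s : R => s *: u)) => // s _; exact: scalel_continuous. Qed.

(** A compact segment of the line which meets [K] has a last point in [K]; if the
    segment ends outside [K], this last point is on the boundary. *)
Lemma last_exit K u (e b : R) : closed K -> e <= b ->
  K (e *: u) -> ~ K (b *: u) ->
  exists2 s, e <= s < b & boundary K (s *: u).
Proof.
move=> cK eb Ke Kb.
pose A := `[e, b]%classic `&` [set s : R | K (s *: u)].
have A0 : A !=set0 by exists e; split => //=; rewrite in_itv/= lexx.
have cA : compact A.
  apply: (subclosed_compact _ (@segment_compact _ e b)) => [|s []//].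
  by apply: closedI; [exact: interval_closed|exact: line_preimage_closed].
have cid : {within A, continuous (idfun : R -> R)}.
  by apply: continuous_subspaceT => x; exact: cvg_id.
have [c] := compact_EVT_max A0 cA cid.
rewrite inE => -[/=]; rewrite in_itv/= => /andP[ec cb] Kc maxc.
have {}cb : c < b by rewrite lt_neqAle cb andbT; apply/eqP => cE; apply: Kb; rewrite -cE.
exists c; first by rewrite ec.
split; first exact: subset_closure.
move=> iKc; have /nbhs_ballP[d/= d0 dK] := @scalel_continuous R _ u c _ iKc.
pose m := Num.min (d / 2) (b - c).
have m0 : 0 < m by rewrite lt_min divr_gt0// subr_gt0.
have : c + m <= c.
  apply: maxc; rewrite inE; split => /=.
    have mb : m <= b - c by rewrite ge_min lexx orbT.
    by rewrite in_itv/=; apply/andP; split; lra.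
  apply: dK; rewrite /ball/= opprD addNKr normrN gtr0_norm//.
  by rewrite (@le_lt_trans _ _ (d / 2))// ?ge_min ?lexx// ltr_pdivrMr// mulr2n mulrDr mulr1 ltrDl.
by rewrite gerDl leNgt m0.
Qed.

Lemma interior_origin_scale K u : interior K 0 ->
  exists2 e, 0 < e & forall s, `|s| <= e -> K (s *: u).
Proof.
move=> K0; have h : nbhs ((0 : R) *: u) K by rewrite scale0r.
have /nbhs_ballP[d/= d0 dK] := @scalel_continuous R _ u 0 _ h.
exists (d / 2); first by rewrite divr_gt0.
move=> s sd; apply: dK; rewrite /ball/= sub0r normrN (le_lt_trans sd)//.
by rewrite ltr_pdivrMr// mulr2n mulrDr mulr1 ltrDl.
Qed.

Lemma bounded_scale_out K u : bounded_set K -> u != 0 ->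
  exists2 b, 0 < b & forall s, b <= s -> ~ K (s *: u).
Proof.
move=> [M [_ MK]] u0; have nu : 0 < `|u| by rewrite normr_gt0.
exists ((`|M| + 2) / `|u|); first by rewrite divr_gt0// ltr_wpDl.
move=> s; rewrite ler_pdivrMr// => sb Ks.
have /= := MK (`|M| + 1) _ _ Ks.
have /[swap]/[apply] : M < `|M| + 1 by rewrite (le_lt_trans (ler_norm M))// ltrDl.
rewrite normrZ => h; have := le_trans (ler_wpM2r (ltW nu) (ler_norm s)) h.
by move/(le_trans sb); rewrite lerD2l; lra.
Qed.

(** If [t x] were missing from [K] for some [0 < t < 1], the line through [x]
    would leave [K] three times: once between the origin and [t x], once beyond
    [x], and once on the opposite side.  This contradicts having only two
    boundary points apart from the origin. *)
Lemma star_shaped K x (t : R) : star_body K -> K x -> 0 <= t <= 1 -> K (t *: x).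
Proof.
move=> [cK bK lK iK _] Kx /andP[t0 t1].
have K0 : K 0 by exact: interior_subset.
have [->|x0] := eqVneq x 0; first by rewrite scaler0.
apply: contrapT => Kt.
have {}t1 : t < 1.
  by rewrite lt_neqAle t1 andbT; apply/eqP => tE; apply: Kt; rewrite tE scale1r.
have [e e0 eK] := interior_origin_scale x iK.
have [b b0 bKb] := bounded_scale_out bK x0.
have Nx0 : - x != 0 by rewrite oppr_eq0.
have [b' b'0 bKb'] := bounded_scale_out bK Nx0.
have et : e < t.
  by rewrite ltNge; apply/negP => te; apply: Kt; apply: eK; rewrite ger0_norm.
(* The three exits: before [t x], beyond [x], and on the opposite ray. *)
have [s0 /andP[es0 s0t] bs0] : exists2 s, e <= s < t & boundary K (s *: x).
  by apply: last_exit => //; [exact: ltW|apply: eK; rewrite gtr0_norm].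
have b1 : 1 < b.
  by rewrite ltNge; apply/negP => b1; apply: (bKb 1) => //; rewrite scale1r.
have [s1 /andP[s1_ge1 _] bs1] : exists2 s, 1 <= s < b & boundary K (s *: x).
  by apply: last_exit => //; [exact: ltW|rewrite scale1r|exact: bKb].
have eb' : e < b'.
  rewrite ltNge; apply/negP => te; apply: (bKb' b') => //.
  by rewrite scalerN -scaleNr; apply: eK; rewrite normrN gtr0_norm.
have [s2 /andP[s2e _] bs2] : exists2 s, e <= s < b' & boundary K (s *: (- x)).
  apply: last_exit => //; [exact: ltW| |exact: bKb'].
  by rewrite scalerN -scaleNr; apply: eK; rewrite normrN gtr0_norm.
have [p [q [pq E]]] := lK x x0.
have on s : s != 0 -> boundary K (s *: x) -> s *: x = p \/ s *: x = q.
  move=> s_neq0 bs; have : ((line x `&` boundary K) `\ (0 : 'rV[R]_n)) (s *: x).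
    split; first by split => //; exists s.
    by move=> /eqP; rewrite scaler_eq0 (negbTE s_neq0) (negbTE x0).
  by rewrite E => -[->|->]; [left|right].
have inj (r s : R) : r *: x = s *: x -> r = s.
  move=> /eqP; rewrite -subr_eq0 -scalerBl scaler_eq0 (negbTE x0) orbF subr_eq0.
  by move/eqP.
rewrite scalerN -scaleNr in bs2.
have s00 : s0 != 0 by rewrite gt_eqF// (lt_le_trans e0).
have s10 : s1 != 0 by rewrite gt_eqF// (lt_le_trans ltr01).
have s20 : - s2 != 0 by rewrite oppr_eq0 gt_eqF// (lt_le_trans e0).
have d01 : s0 <> s1 by lra.
have d02 : s0 <> - s2 by lra.
have d12 : s1 <> - s2 by lra.
have [h0|h0] := on _ s00 bs0; have [h1|h1] := on _ s10 bs1; have [h2|h2] := on _ s20 bs2;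
  first [by apply: d01; apply: inj; rewrite h0 h1
        |by apply: d02; apply: inj; rewrite h0 h2
        |by apply: d12; apply: inj; rewrite h1 h2].
Qed.

Lemma gauge_set_neq0 K x : star_body K ->
  [set a : R | 0 <= a /\ exists2 y, K y & x = a *: y] !=set0.
Proof.
move=> [_ _ _ iK _]; have [e e0 eK] := interior_origin_scale x iK.
exists e^-1; split; first by rewrite invr_ge0 ltW.
exists (e *: x); first by apply: eK; rewrite gtr0_norm.
by rewrite scalerA mulVf ?scale1r// gt_eqF.
Qed.

Lemma gauge_ge0 K x : star_body K -> 0 <= gauge K x.
Proof. by move=> sK; apply: lb_le_inf => [|a []//]; exact: gauge_set_neq0. Qed.

(** The closedness of [K] is what makes the infimum in the gauge attained. *)
Lemma gauge_le K x (a : R) : star_body K -> 0 < a ->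
  gauge K x <= a <-> K (a^-1 *: x).
Proof.
move=> sK a0; split => [xa|Kx]; last first.
  apply: ge_inf; first by exists 0 => b [].
  split; first exact: ltW.
  by exists (a^-1 *: x) => //; rewrite scalerA mulfV ?scale1r// gt_eqF.
have h (r : R) : 0 < r -> r < a^-1 -> K (r *: x).
  move=> r0 ra.
  have ra' : gauge K x < r^-1.
    by rewrite (le_lt_trans xa)// -[ltLHS]invrK ltf_pV2 ?posrE ?invr_gt0.
  have [b [b0 [y Ky ->]] br] := inf_lt (gauge_set_neq0 x sK) ra'.
  rewrite scalerA; apply: star_shaped => //.
  rewrite mulr_ge0 ?(ltW r0)//=; have := ltW br.
  by rewrite -ler_pdivlMl ?invr_gt0 ?invrK ?mulr1.
apply: contrapT => NK.
have cK : closed K by case: sK.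
have oC : open (~` [set s : R | K (s *: x)]) by rewrite openC; exact: line_preimage_closed.
have /nbhs_ballP[d/= d0 dK] : nbhs a^-1 (~` [set s : R | K (s *: x)]) by exact: open_nbhs_nbhs.
have a0' : 0 < a^-1 by rewrite invr_gt0.
pose m := Num.min (d / 2) (a^-1 / 2).
have m0 : 0 < m by rewrite lt_min !divr_gt0.
have md : m <= d / 2 by rewrite ge_min lexx.
have ma : m <= a^-1 / 2 by rewrite ge_min lexx orbT.
apply: (dK (a^-1 - m)).
  by rewrite /ball/= opprB addrC subrK gtr0_norm//; lra.
by apply: h; lra.
Qed.

Lemma gauge_le1 K x : star_body K -> K x <-> gauge K x <= 1.
Proof. by move=> sK; rewrite gauge_le// invr1 scale1r. Qed.

(** Both sides have the same upper bounds, by [gauge_le]. *)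
Lemma gaugeZ K x (s : R) : star_body K -> 0 < s ->
  gauge K (s *: x) = s * gauge K x.
Proof.
move=> sK s0.
have E (a : R) : 0 < a -> gauge K (s *: x) <= a <-> s * gauge K x <= a.
  move=> a0; have sa0 : 0 < s^-1 * a by rewrite mulr_gt0// invr_gt0.
  rewrite -ler_pdivlMl//; apply: iff_trans (gauge_le _ sK a0) _.
  apply: iff_sym; apply: iff_trans (gauge_le _ sK sa0) _.
  by rewrite scalerA invfM invrK [s * _]mulrC.
have g0 := gauge_ge0 x sK; have gs0 := gauge_ge0 (s *: x) sK.
apply: le_anti; apply/andP; split.
  apply/ler_addgt0Pr => e e0; apply/E; last by rewrite lerDl ltW.
  by rewrite ltr_wpDl// mulr_ge0// ltW.
apply/ler_addgt0Pr => e e0; apply/E; last by rewrite lerDl ltW.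
by rewrite ltr_wpDl.
Qed.

Lemma gauge_gt0 K x : star_body K -> x != 0 -> 0 < gauge K x.
Proof.
move=> sK x0; have bK : bounded_set K by case: sK.
have [b b0 bKb] := bounded_scale_out bK x0.
rewrite ltNge; apply/negP => g0; apply: (bKb b) => //.
rewrite -(invrK b); apply/gauge_le; rewrite ?invr_gt0//.
by rewrite (le_trans g0)// invr_ge0 ltW.
Qed.

End star.

(** * Integrals along rays through a star body *)

Section parameter.
Context {R : realType}.

(** The tube lemma: joint continuity is uniform along a compact set of second
    variables. *)
Lemma near_uniform_compact (X Y : topologicalType) (G : X -> Y -> R) (x0 : X) (K : set Y) :
  compact K -> (forall y, K y -> {for (x0, y), continuous (fun p => G p.1 p.2)}) ->
  forall e, 0 < e -> \forall x \near x0, forall y, K y -> `|G x y - G x0 y| <= e.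
Proof.
move=> /compact_near_coveringP cK cG e e0.
apply: (cK X (nbhs x0) (fun x y => `|G x y - G x0 y| <= e)) => y Ky.
have e20 : 0 < e / 2 by rewrite divr_gt0.
have /cvgr_dist_lt/(_ _ e20)[[A B]/= [Ax By] AB] := cG y Ky.
exists (B, A); first by split.
move=> [y' x]/= [By' Ax'].
have h1 := AB (x, y') (conj Ax' By').
have h2 := AB (x0, y') (conj (nbhs_singleton Ax) By').
rewrite /= in h1 h2.
rewrite (_ : G x y' - G x0 y' = (G x0 y - G x0 y') - (G x0 y - G x y')); last by ring.
by apply: le_trans (ler_normB _ _) _; lra.
Qed.

Lemma cvg_Rintegral_uniform (X : topologicalType) d (Y : measurableType d)
    (mu : {measure set Y -> \bar R}) (D : set Y) (G : X -> Y -> R) (x0 : X) (M : R) :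
  measurable D -> (mu D < +oo)%E ->
  (forall x, measurable_fun D (G x)) -> (forall y, D y -> `|G x0 y| <= M) ->
  (forall e, 0 < e -> \forall x \near x0, forall y, D y -> `|G x y - G x0 y| <= e) ->
  {for x0, continuous (fun x => \int[mu]_(y in D) G x y)}.
Proof.
move=> mD Doo mG GM uG.
have bint (g : Y -> R) N : measurable_fun D g -> (forall y, D y -> `|g y| <= N) ->
    mu.-integrable D (EFin \o g).
  move=> mg gN; apply: measurable_bounded_integrable => //.
  exists N; split; rewrite ?num_real// => N' NN' y /= Dy.
  by rewrite (le_trans (gN y Dy))// ltW.
have i0 := bint _ _ (mG x0) GM.
have muD0 : 0 <= fine (mu D) by rewrite fine_ge0.
apply/cvgrPdist_le => e e0.
pose e' := e / (fine (mu D) + 1).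
have e'0 : 0 < e' by rewrite divr_gt0// ltr_wpDl.
near=> x.
have hx : forall y, D y -> `|G x y - G x0 y| <= e' by near: x; exact: uG.
have ix : mu.-integrable D (EFin \o G x).
  apply: (bint _ (M + e')) => // y Dy.
  rewrite -(subrK (G x0 y) (G x y)) addrC (le_trans (ler_normD _ _))//.
  by rewrite lerD ?GM ?hx.
rewrite -RintegralB//.
apply: le_trans (le_normr_Rintegral mD _) _.
  apply: (bint _ e'); first exact: measurable_funB.
  by move=> y Dy; rewrite distrC hx.
apply: le_trans (_ : \int[mu]_(y in D) e' <= _).
  apply: le_Rintegral => //.
  - apply: (bint _ e') => [|y Dy]; last by rewrite normr_id distrC hx.
    by apply: measurableT_comp => //; exact: measurable_funB.
  - by apply: (bint _ e') => // y Dy; rewrite gtr0_norm.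
  - by move=> y Dy; rewrite distrC hx.
rewrite Rintegral_cst// /e' -mulrA ler_piMr ?(ltW e0)// mulrC ler_pdivrMr ?ltr_wpDl//.
by rewrite mul1r lerDl.
Unshelve. all: by end_near. Qed.

Lemma continuous_measurable_row n (f : 'rV[R]_n -> R) : continuous f ->
  measurable_fun setT (f : borel 'rV[R]_n -> measurableTypeR R).
Proof.
move=> cf; apply: (measurability _ (RGenOpens.measurableE R)).
move=> _ [_ [a [b ->] <-]]; rewrite setTI; apply: sub_sigma_algebra.
by move/continuousP : cf; apply; exact: interval_open.
Qed.

Lemma closed_measurable_row n (K : set 'rV[R]_n) : closed K -> measurable (K : set (borel 'rV[R]_n)).
Proof.
by move=> cK; rewrite -(setCK K); apply: measurableC; apply: sub_sigma_algebra; exact: closed_openC.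
Qed.

End parameter.

Section ray_star.
Context {R : realType} (n m : nat) (f : 'rV[R]_n -> R).
Hypothesis cf : continuous f.

(** The integral along a ray up to a boundary point [y] of a star body: it
    mentions [f] only, which separates the continuity in [y] from the choice of
    the body. *)
Definition segment_integral (y : 'rV[R]_n) : R :=
  \int[lebesgue_measure]_(r in `[0, 1]) (r ^+ m.-1 * f (r *: y)).

Let segment_cts y : continuous (fun r : R => r ^+ m.-1 * f (r *: y)).
Proof.
move=> r; apply: cvgM; first exact: exprn_continuous.
by apply: (@continuous_comp _ _ _ (fun r : R => r *: y) f); [exact: scalel_continuous|exact: cf].
Qed.

Let segment_integrable y :
  lebesgue_measure.-integrable `[0, 1] (EFin \o (fun r : R => r ^+ m.-1 * f (r *: y))).
Proof.
apply: continuous_compact_integrable; first exact: segment_compact.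
exact: continuous_subspaceT.
Qed.

Lemma segment_integral_continuous : continuous segment_integral.
Proof.
move=> y0.
have [M [_ HM]] : bounded_set ((fun r : R => r ^+ m.-1 * f (r *: y0)) @` `[0, 1]).
  apply: compact_bounded; apply: continuous_compact; last exact: segment_compact.
  exact: continuous_subspaceT.
apply: (@cvg_Rintegral_uniform R 'rV[R]_n _ (measurableTypeR R) lebesgue_measure
  `[0, 1]%classic (fun y r => r ^+ m.-1 * f (r *: y)) y0 (M + 1)) => //.
- by rewrite /= lebesgue_measure_itv/= lte_fin ltr01 -EFinD ltry.
- move=> y; apply: measurable_funTS; exact: (continuous_measurable_fun (@segment_cts y)).
- by move=> r r01; apply: HM; [rewrite ltrDl|exists r].
apply: near_uniform_compact; first exact: segment_compact.
move=> r _.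
have c1 : {for (y0, r), continuous (fun p : 'rV[R]_n * R => p.2 ^+ m.-1)}.
  by apply: (@cvg_exprn R _ (nbhs (y0, r)) _ snd); exact: cvg_snd.
have c2 : {for (y0, r), continuous (f \o (fun p : 'rV[R]_n * R => p.2 *: p.1))}.
  by apply: continuous_comp; [apply: cvgZ; [exact: cvg_snd|exact: cvg_fst]|exact: cf].
exact: cvgM c1 c2.
Qed.

Hypothesis f0 : forall x, 0 <= f x.
Hypothesis m0 : (0 < m)%N.

Definition body_density (K : set 'rV[R]_n) (x : borel 'rV[R]_n) : \bar R := (\1_K x * f x)%:E.

Lemma body_density_ge0 K x : (0 <= body_density K x)%E.
Proof. by rewrite lee_fin mulr_ge0. Qed.

Lemma measurable_body_density K : measurable (K : set (borel 'rV[R]_n)) ->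
  measurable_fun setT (body_density K).
Proof.
move=> mK; apply/measurable_EFinP; apply: measurable_funM.
  exact: measurable_indic.
exact: continuous_measurable_row.
Qed.

Lemma ray_integral_gauge1 K (y : 'rV[R]_n) : star_body K -> gauge K y = 1 ->
  ray_integral m (body_density K) y = (segment_integral y)%:E.
Proof.
move=> sK y1.
rewrite /segment_integral /Rintegral fineK; last first.
  by apply: integrable_fin_num => //; exact: (@segment_integrable y).
rewrite -integral_itv_obnd_cbnd; last first.
  by apply/measurable_EFinP; apply: measurable_funTS; exact: (continuous_measurable_fun (@segment_cts y)).
rewrite [RHS]integral_mkcond; apply: eq_integral => r _.
rewrite /patch mem_setE in_itv/= /ray_weight /body_density indicE.
case: (ltP 0 r) => r0 /=; last by rewrite mul0e.
case: (boolP (r <= 1)) => r1.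
  rewrite mem_set ?mul1r -?EFinM//; apply/gauge_le1 => //.
  by rewrite gaugeZ// y1 mulr1.
rewrite memNset ?mul0r ?mule0//; apply/gauge_le1 => //.
by rewrite gaugeZ// y1 mulr1; apply/negP.
Qed.

(** Rescale [x] to the boundary point [radial K x *: x], where the ray leaves [K]
    at time 1. *)
Lemma ray_integral_star K (x : 'rV[R]_n) : star_body K -> x != 0 ->
  ray_integral m (body_density K) x =
  (radial K x ^+ m * segment_integral (radial K x *: x))%:E.
Proof.
move=> sK x0; have g0 := gauge_gt0 sK x0.
have r0 : 0 < radial K x by rewrite invr_gt0.
have mK : measurable (K : set (borel 'rV[R]_n)) by apply: closed_measurable_row; case: sK.
rewrite EFinM -(@ray_integral_gauge1 K)//; last by rewrite gaugeZ// mulVf// gt_eqF.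
rewrite ray_integralZ//; last 2 first.
- exact: measurable_body_density.
- exact: body_density_ge0.
by rewrite muleA -EFinM mulfV ?mul1e// expf_neq0// gt_eqF.
Qed.

(** Continuous form of the integral of [f] along the part of the ray in
    [K `\` L]. *)
Definition ray_diff K L (x : 'rV[R]_n) : R :=
  radial K x ^+ m * segment_integral (radial K x *: x) -
  radial L x ^+ m * segment_integral (radial L x *: x).

Lemma ray_integral_diff K L (x : 'rV[R]_n) : star_body K -> star_body L -> L `<=` K -> x != 0 ->
  ray_integral m (body_density (K `\` L)) x = (ray_diff K L x)%:E.
Proof.
move=> sK sL LK x0.
have mK : measurable (K : set (borel 'rV[R]_n)) by apply: closed_measurable_row; case: sK.
have mL : measurable (L : set (borel 'rV[R]_n)) by apply: closed_measurable_row; case: sL.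
have mKL : measurable (K `\` L : set (borel 'rV[R]_n)) by exact: measurableD.
have mb K' (mK' : measurable (K' : set (borel 'rV[R]_n))) : measurable_fun setT (fun r : measurableTypeR R =>
    ((ray_weight m r)%:E * body_density K' (r *: x))%E).
  exact: (measurableT_comp (measurable_ray_integrand m (measurable_body_density mK')) (pair1_measurable (x : borel 'rV[R]_n))).
have E : ray_integral m (body_density K) x =
    (ray_integral m (body_density (K `\` L)) x + ray_integral m (body_density L) x)%E.
  rewrite /ray_integral -ge0_integralD//; try exact: mb; try by
    move=> r _; apply: ray_integrand_ge0; exact: body_density_ge0.
  apply: eq_integral => r _; rewrite -EFinM -!EFinM -EFinD; congr _%:E.
  rewrite -mulrDr; congr (_ * _); rewrite -mulrDl; congr (_ * _).
  rewrite !indicE -natrD; congr (_%:R).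
  have [Lr|NLr] := pselect (L (r *: x)).
    by rewrite (mem_set (LK _ Lr)) (mem_set Lr) memNset// => -[].
  rewrite (memNset NLr) addn0; congr nat_of_bool.
  by apply/idP/idP => /set_mem h; apply/mem_set; [split|case: h].
move: E; rewrite (ray_integral_star sK x0) (ray_integral_star sL x0) /ray_diff => E.
by rewrite EFinB E addeK.
Qed.

Lemma radial_continuous K (x : 'rV[R]_n) : star_body K -> x != 0 ->
  {for x, continuous (radial K)}.
Proof.
move=> sK x0; have g0 : gauge K x != 0 by rewrite gt_eqF// gauge_gt0.
have cg : continuous (gauge K) by case: sK.
exact: (cvgV g0 (cg x)).
Qed.

Lemma ray_diff_continuous K L (x : 'rV[R]_n) : star_body K -> star_body L -> x != 0 ->
  {for x, continuous (ray_diff K L)}.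
Proof.
move=> sK sL x0.
have c K' (sK' : star_body K') : {for x, continuous (fun x => radial K' x ^+ m * segment_integral (radial K' x *: x))}.
  have cr := radial_continuous sK' x0.
  have c1 : {for x, continuous (fun x => radial K' x ^+ m)}.
    exact: (@cvg_exprn R _ (nbhs x) _ (radial K') _ m cr).
  have c2 : {for x, continuous (segment_integral \o (fun x => radial K' x *: x))}.
    apply: continuous_comp; last exact: segment_integral_continuous.
    by apply: (cvgZ cr); exact: cvg_id.
  exact: cvgM c1 c2.
exact: cvgB (c K sK) (c L sL).
Qed.

End ray_star.

(** * Orthonormal frames of subspaces *)

Section stiefel.
Context {R : realType}.

(** The frame of a point of the Grassmannian is a fixed but arbitrary choice, so
    the frame [A] of the subspace can be recovered only up to rotation. *)
Lemma gr_of_isometry n k (A : 'M[R]_(n - k, n)) : A *m A^T = 1%:M ->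
  exists F : Gr R n k, exists2 Q : 'M[R]_(n - k), Q *m Q^T = 1%:M & frame F = Q *m A.
Proof.
move=> A1.
pose F := limg (linfun (mulmxr A : 'rV[R]_(n - k) -> 'rV[R]_n)).
have FP x : x \in F -> exists u, x = u *m A.
  by case/memv_imgP => u _ ->; exists u; rewrite lfunE.
have dF : \dim F == (n - k)%N.
  rewrite limg_dim_eq; first by rewrite dimvf /dim /= mul1n.
  rewrite capfv; apply/eqP; rewrite -subv0; apply/subvP => u.
  rewrite memv_ker lfunE /= => /eqP uA; rewrite memv0; apply/eqP.
  by rewrite -[u]mulmx1 -A1 mulmxA uA mul0mx.
exists (exist _ F dF).
have [fr1 frF] := projT2 (cid (exists_frame (eqP (valP (exist _ F dF : Gr R n k))))).
rewrite -/(frame (exist _ F dF : Gr R n k)) in fr1 frF.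
set B := frame _ in fr1 frF *.
have BA : B *m A^T *m A = B.
  apply/row_matrixP => i; rewrite !row_mul.
  have /FP[u ->] : row i B \in F by rewrite frF row_sub.
  by rewrite -(mulmxA u) A1 mulmx1.
exists (B *m A^T) => //.
by rewrite trmx_mul trmxK mulmxA BA.
Qed.

Lemma frame_isometry n k (F : Gr R n k) : frame F *m (frame F)^T = 1%:M.
Proof. by have [] := projT2 (cid (exists_frame (eqP (valP F)))). Qed.

Lemma frame_memP n k (F : Gr R n k) (x : 'rV[R]_n) : (x \in val F) = (x <= frame F)%MS.
Proof. by have [_] := projT2 (cid (exists_frame (eqP (valP F)))). Qed.

(** Complete [x] to a basis of the space and keep its first [n - k] vectors. *)
Lemma gr_through n k (x : 'rV[R]_n) : (k < n)%N -> x != 0 ->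
  exists F : Gr R n k, x \in val F.
Proof.
move=> kn x0.
pose X := x :: vbasis (<[x]>^C)%VS.
have fX : free X.
  rewrite free_cons (basis_free (vbasisP _)) andbT (span_basis (vbasisP _)).
  apply: contra x0 => xC; have : x \in (<[x]> :&: <[x]>^C)%VS by rewrite memv_cap memv_line.
  by rewrite capv_compl memv0.
have sX : size X = n.
  by rewrite /= size_tuple dimv_compl dim_vline x0 dimvf /dim /= mul1n subnSK ?subn0// (leq_ltn_trans _ kn).
have dF : \dim <<take (n - k) X>>%VS == (n - k)%N.
  apply/eqP; have : free (take (n - k) X).
    by move: fX; rewrite -{1}(cat_take_drop (n - k) X) => /catl_free.
  by rewrite /free => /eqP ->; rewrite size_takel// sX leq_subr.
exists (exist (fun F : {vspace 'rV[R]_n} => \dim F == (n - k)%N) _ dF) => /=; apply: memv_span.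
have : (0 < n - k)%N by rewrite subn_gt0.
by case: (n - k)%N => // j _; rewrite /= mem_head.
Qed.

Lemma cvg_mx (T : Type) (F : set_system T) {FF : Filter F} m n (f : T -> 'M[R]_(m, n)) (l : 'M[R]_(m, n)) :
  (forall i j, f x i j @[x --> F] --> l i j) -> f x @[x --> F] --> l.
Proof.
move=> fl; apply/cvg_ballP => e e0.
have : \forall x \near F, forall ij : 'I_m * 'I_n, ball (l ij.1 ij.2) e (f x ij.1 ij.2).
  by apply: filter_forall => -[i j]; apply: (cvg_ball (fl i j)).
by apply: filterS => x h; split => // i j; exact: (h (i, j)).
Qed.

Lemma unit_sphere_compact n : compact (@unit_sphere R n).
Proof.
apply: bounded_closed_compact.
  exists 1; split => // M M1 x /= x1.
  by apply: le_trans (norm_le_enorm x) _; rewrite x1 ltW.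
have -> : @unit_sphere R n = @enorm R n @^-1` [set 1] by [].
by apply: closed_comp => // x _; exact: enorm_continuous.
Qed.

End stiefel.

(** * Integrals over central sections *)

Section slices.
Context {R : realType}.

Lemma isometry_neq0 m n (A : 'M[R]_(m, n)) (u : 'rV[R]_m) :
  A *m A^T = 1%:M -> unit_sphere m u -> u *m A != 0.
Proof.
by move=> A1 u1; rewrite -enorm_gt0 enorm_isometry// u1.
Qed.

Lemma sphere_neq0 n (x : 'rV[R]_n) : unit_sphere n x -> x != 0.
Proof. by move=> x1; rewrite -enorm_gt0 x1. Qed.

Lemma sphere_measure_sphere n : (0 < n)%N ->
  sphere_measure n (unit_sphere n : set (borel 'rV[R]_n)) = (n%:R * omega R n)%:E.
Proof.
move=> n0; have mS := @measurable_unit_sphere R n.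
have := @integral_sphere R n (cst 1%E) (@measurable_cst _ _ _ _ _ _) (fun _ => lee01).
rewrite integral_cst// mul1e => ->; rewrite EFinM -lebesgue_unit_ball; congr (_ * _)%E.
under eq_integral do rewrite mule1.
rewrite (integral_indic _ measurableT (@measurable_punctured R n)) setIT.
have -> : unit_ball n `&` [set x : 'rV[R]_n | x != 0] = unit_ball n `\` [set 0].
  by apply/seteqP; split=> x /= [h1 /eqP h2].
rewrite measureD//; last 3 first.
- exact: (@measurable_unit_ball R n).
- exact: measurable_origin.
- exact: lebesgue_unit_ball_lty.
have -> : unit_ball n `&` [set (0 : 'rV[R]_n)] = [set 0].
  by apply/seteqP; split=> [x []//|x /= ->]; split => //; rewrite /unit_ball/= enorm0.
rewrite -[RHS]sube0; congr (_ - _)%E.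
exact: lebesgue_origin.
Qed.

Section density.
Variables (n : nat) (f : 'rV[R]_n -> R).
Hypotheses (cf : continuous f) (f0 : forall x, 0 <= f x).
Local Open Scope ereal_scope.

Lemma measurable_slice m (A : 'M[R]_(m, n)) (B : set 'rV[R]_n) :
  measurable (B : set (borel 'rV[R]_n)) ->
  measurable_fun setT (fun u : borel 'rV[R]_m => body_density f B ((u : 'rV[R]_m) *m A)).
Proof.
move=> mB; have mb := measurable_body_density cf mB.
exact: (measurableT_comp mb (@measurable_mulmx R m n A)).
Qed.

Lemma measurable_gr k (F : Gr R n k) : measurable ([set` val F] : set (borel 'rV[R]_n)).
Proof.
have -> : [set` val F] = [set x : 'rV[R]_n | x *m (orthoproj F - 1%:M) = 0%R].
  apply/seteqP; split => x /=.
    rewrite frame_memP => /submxP[u ->]; rewrite mulmxBr mulmx1 /orthoproj.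
    by rewrite -mulmxA (mulmxA (frame F)) frame_isometry mul1mx subrr.
  move=> h; rewrite frame_memP; apply/submxP; exists (x *m (frame F)^T).
  have xP : x *m orthoproj F = x.
    by apply/eqP; rewrite -subr_eq0; apply/eqP; rewrite -[RHS]h mulmxBr mulmx1.
  by rewrite -mulmxA xP.
have := @measurable_mulmx R n n (orthoproj F - 1%:M) measurableT [set 0%R].
rewrite setTI; apply; apply: closed_measurable_row.
have -> : [set 0%R : 'rV[R]_n] = @enorm R n @^-1` [set 0%R].
  apply/seteqP; split => x /= h; last by apply/eqP; rewrite -enorm_eq0 h.
  by rewrite h enorm0.
by apply: closed_comp => // x _; exact: enorm_continuous.
Qed.

Lemma frame_in k (F : Gr R n k) (u : 'rV[R]_(n - k)) : u *m frame F \in val F.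
Proof. by rewrite frame_memP submxMl. Qed.

Lemma section_massE k (F : Gr R n k) (B : set 'rV[R]_n) :
  measurable (B : set (borel 'rV[R]_n)) ->
  section_mass F f B =
  \int[lebesgue (n - k)]_u body_density f B ((u : 'rV[R]_(n - k)) *m frame F).
Proof.
move=> mB; rewrite /section_mass.
have mBF : measurable ((B `&` [set` val F]) : set (borel 'rV[R]_n)).
  by apply: measurableI => //; exact: measurable_gr.
rewrite integral_image_measure//; last first.
  by apply: measurable_funTS; apply/measurable_EFinP; exact: continuous_measurable_row.
rewrite integral_mkcond; apply: eq_integral => u _; rewrite /patch /body_density indicE.
have [uB|uB] := pselect (B (u *m frame F)).
  by rewrite !mem_set ?mul1r//; split => //; exact: frame_in.
by rewrite !memNset ?mul0r// => -[].
Qed.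

(** A continuous density is bounded on the compact set [B], and [B] pulls back to
    a bounded set because [A] preserves the Euclidean norm. *)
Lemma integral_slice_lty m (A : 'M[R]_(m, n)) (B : set 'rV[R]_n) :
  (A *m A^T = 1%:M)%R -> closed B -> bounded_set B ->
  \int[lebesgue m]_u body_density f B ((u : 'rV[R]_m) *m A) < +oo.
Proof.
move=> A1 cB bB.
have mB : measurable (B : set (borel 'rV[R]_n)) by exact: closed_measurable_row.
have [M [_ HM]] : bounded_set (f @` B).
  apply: compact_bounded; apply: continuous_compact; last exact: bounded_closed_compact.
  exact: continuous_subspaceT.
pose P := [set u : borel 'rV[R]_m | B ((u : 'rV[R]_m) *m A)].
have mP : measurable P.
  by rewrite -[X in measurable X]setTI; exact: (@measurable_mulmx R m n A).
have bP : bounded_set (P : set 'rV[R]_m).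
  move: bB => [N [_ HN]].
  exists (\sum_(i < n) (`|N| + 1) ^+ 2 + 1)%R; split; rewrite ?num_real// => C hC u Pu /=.
  apply: le_trans (norm_le_enorm u) _; rewrite -(enorm_isometry u A1).
  have coordN (i : 'I_n) : (`|(u *m A) ord0 i| <= `|N| + 1)%R.
    have /norm_le_cube : (`|(u *m A)%R| <= `|N| + 1)%R.
      by apply: HN Pu; rewrite (le_lt_trans (ler_norm N))// ltrDl.
    by move=> h; apply: h; rewrite addr_ge0.
  set S := (\sum_(i < n) _)%R in hC.
  have S0 : (0 <= S)%R by apply: sumr_ge0 => i _; exact: sqr_ge0.
  have h2 : (enorm (u *m A) ^+ 2 <= S)%R.
    rewrite sqr_enorm; apply: ler_sum => i _.
    by rewrite -real_normK ?num_real// lerXn2r// ?nnegrE// addr_ge0.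
  have e0 := enorm_ge0 (u *m A).
  nra.
apply: le_lt_trans (_ : \int[lebesgue m]_u ((`|M| + 1)%:E * (\1_P u)%:E) < +oo).
  apply: ge0_le_integral => //.
  - by move=> u _; exact: body_density_ge0.
  - exact: measurable_slice.
  - apply: emeasurable_funM => //; apply/measurable_EFinP; exact: measurable_indic.
  - move=> u _; rewrite /body_density -EFinM lee_fin !indicE.
    have [uB|uB] := pselect (B (u *m A)).
      rewrite !mem_set// mul1r mulr1; apply: le_trans (ler_norm _) _.
      by apply: HM; [rewrite (le_lt_trans (ler_norm M))// ltrDl|exists (u *m A)].
    by rewrite !memNset// mul0r mulr0.
rewrite ge0_integralZl_EFin//; last first.
  by apply/measurable_EFinP; exact: measurable_indic.
rewrite (integral_indic _ measurableT mP) setIT lte_mul_pinfty ?lee_fin//.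
exact: lebesgue_bounded.
Qed.

(** The integral over [K] splits into those over [K `\` L] and over [L]; the latter
    is finite and cancels. *)
Lemma integral_slice_diff m (A : 'M[R]_(m, n)) (K L : set 'rV[R]_n) :
  (A *m A^T = 1%:M)%R -> closed K -> closed L -> bounded_set L -> L `<=` K ->
  \int[lebesgue m]_u body_density f K ((u : 'rV[R]_m) *m A) -
  \int[lebesgue m]_u body_density f L ((u : 'rV[R]_m) *m A) =
  \int[lebesgue m]_u body_density f (K `\` L) ((u : 'rV[R]_m) *m A).
Proof.
move=> A1 cK cL bL LK.
have mK : measurable (K : set (borel 'rV[R]_n)) by exact: closed_measurable_row.
have mL : measurable (L : set (borel 'rV[R]_n)) by exact: closed_measurable_row.
have mKL : measurable ((K `\` L) : set (borel 'rV[R]_n)) by exact: measurableD.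
have -> : \int[lebesgue m]_u body_density f K ((u : 'rV[R]_m) *m A) =
    \int[lebesgue m]_u body_density f (K `\` L) ((u : 'rV[R]_m) *m A) +
    \int[lebesgue m]_u body_density f L ((u : 'rV[R]_m) *m A).
  rewrite -ge0_integralD//; try exact: measurable_slice; try by
    move=> r _; exact: body_density_ge0.
  apply: eq_integral => u _; rewrite -EFinD; congr _%:E.
  rewrite -mulrDl; congr (_ * _)%R; rewrite !indicE -natrD; congr (_%:R)%R.
  have [Lr|NLr] := pselect (L (u *m A)).
    by rewrite (mem_set (LK _ Lr)) (mem_set Lr) memNset// => -[].
  rewrite (memNset NLr) addn0; congr nat_of_bool.
  by apply/idP/idP => /set_mem h; apply/mem_set; [split|case: h].
rewrite addeK// ge0_fin_numE; first exact: integral_slice_lty.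
by apply: integral_ge0 => u _; exact: body_density_ge0.
Qed.

End density.

End slices.

(** * Section masses as spherical integrals *)

Section maximal_section.
Context {R : realType} (n m : nat) (f : 'rV[R]_n -> R) (K L : set 'rV[R]_n).
Hypotheses (m0 : (0 < m)%N) (cf : continuous f) (f0 : forall x, 0 <= f x).
Hypotheses (sK : star_body K) (sL : star_body L) (LK : L `<=` K).

Let mK : measurable (K : set (borel 'rV[R]_n)).
Proof. by apply: closed_measurable_row; case: sK. Qed.

Let mL : measurable (L : set (borel 'rV[R]_n)).
Proof. by apply: closed_measurable_row; case: sL. Qed.

Let mKL : measurable (K `\` L : set (borel 'rV[R]_n)).
Proof. exact: measurableD. Qed.

Let mh := measurable_body_density cf mKL.
Let h0 := body_density_ge0 f0 (K `\` L).

(** This is [ray_diff m f K L] away from the origin; taking the real part of the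
    ray integral makes measurability and nonnegativity hold everywhere. *)
Definition ray_mass (x : borel 'rV[R]_n) : R :=
  fine (ray_integral m (body_density f (K `\` L)) x).

Lemma measurable_ray_mass : measurable_fun setT (ray_mass : _ -> measurableTypeR R).
Proof.
by apply: (measurableT_comp (fine_measurable measurableT)) => //; exact: measurable_ray_integral.
Qed.

Lemma ray_mass_ge0 x : 0 <= ray_mass x.
Proof. by apply: fine_ge0; exact: ray_integral_ge0. Qed.

Lemma ray_massE (x : 'rV[R]_n) : x != 0 ->
  ray_integral m (body_density f (K `\` L)) x = (ray_mass x)%:E.
Proof. by move=> x0; rewrite /ray_mass (ray_integral_diff cf f0 m0 sK sL LK x0). Qed.

Lemma ray_mass_continuous (x : 'rV[R]_n) : x != 0 -> {for x, continuous (ray_mass : 'rV[R]_n -> R)}.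
Proof.
move=> x0.
have E (y : 'rV[R]_n) : y != 0 -> ray_diff m f K L y = ray_mass y.
  by move=> y0; rewrite /ray_mass (ray_integral_diff cf f0 m0 sK sL LK y0).
have cd : ray_diff m f K L @ x --> ray_diff m f K L x.
  exact: (@ray_diff_continuous R n m f cf K L x sK sL x0).
have nE : \forall y \near nbhs x, ray_diff m f K L y = ray_mass y.
  have : nbhs x [set y : 'rV[R]_n | y != 0].
    apply: open_nbhs_nbhs; split => //.
    have -> : [set y : 'rV[R]_n | y != 0] = @enorm R n @^-1` [set t | 0 < t].
      by apply/seteqP; split => y /=; rewrite enorm_gt0.
    by apply: open_comp => [y _|]; [exact: enorm_continuous|exact: open_gt].
  by apply: filterS => y; exact: E.
suff : (ray_mass : 'rV[R]_n -> R) @ x --> ray_mass x by [].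
rewrite -(E x x0); apply: cvg_trans cd.
exact: near_eq_cvg nE.
Qed.

Definition sphere_mass (A : 'M[R]_(m, n)) : R :=
  \int[sphere_measure m]_(u in unit_sphere m) ray_mass (u *m A).

Let mray A : measurable_fun setT (fun u : borel 'rV[R]_m => ray_mass ((u : 'rV[R]_m) *m A) : measurableTypeR R).
Proof. exact: (measurableT_comp measurable_ray_mass (@measurable_mulmx R m n A)). Qed.

Let slice_continuous (v : 'rV[R]_(m * n)) u :
  vec_mx v *m (vec_mx v)^T = 1%:M -> unit_sphere m u ->
  {for (v, u), continuous (fun p : 'rV[R]_(m * n) * 'rV[R]_m => ray_mass (p.2 *m vec_mx p.1))}.
Proof.
move=> v1 u1.
apply: (@continuous_comp _ _ _ (fun p : 'rV[R]_(m * n) * 'rV[R]_m => p.2 *m vec_mx p.1) (ray_mass : 'rV[R]_n -> R)); last first.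
  by apply: ray_mass_continuous; exact: isometry_neq0.
apply: (@cvg_mx R _ (nbhs (v, u)) _) => i j; rewrite mxE.
under eq_cvg do rewrite mxE.
apply: (@cvg_sumr R _ _ (nbhs (v, u)) _) => k.
have c1 : {for (v, u), continuous (fun p : 'rV[R]_(m * n) * 'rV[R]_m => p.2 i k)}.
  apply: (@continuous_comp _ _ _ snd (fun w : 'rV[R]_m => w i k)); first exact: cvg_snd.
  exact: coord_continuous.
have c2 : {for (v, u), continuous (fun p : 'rV[R]_(m * n) * 'rV[R]_m => vec_mx p.1 k j)}.
  rewrite [X in {for _, continuous X}](_ : _ = (fun w : 'rV[R]_(m * n) => w ord0 (mxvec_index k j)) \o fst); last first.
    by apply/funext => p; rewrite /= mxE.
  apply: continuous_comp; first exact: cvg_fst.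
  exact: coord_continuous.
exact: cvgM c1 c2.
Qed.

Lemma ray_mass_slice_bounded (A : 'M[R]_(m, n)) : A *m A^T = 1%:M ->
  exists M, forall u, unit_sphere m u -> `|ray_mass (u *m A)| <= M.
Proof.
move=> A1.
have c : {within unit_sphere m, continuous (fun u : 'rV[R]_m => ray_mass (u *m A))}.
  apply: continuous_in_subspaceT => u; rewrite inE => u1.
  have vA : vec_mx (mxvec A) *m (vec_mx (mxvec A))^T = 1%:M by rewrite mxvecK.
  rewrite (_ : (fun u : 'rV[R]_m => ray_mass (u *m A)) =
    (fun p : 'rV[R]_(m * n) * 'rV[R]_m => ray_mass (p.2 *m vec_mx p.1)) \o (fun u => (mxvec A, u))); last first.
    by apply/funext => w /=; rewrite mxvecK.
  apply: continuous_comp; last exact: slice_continuous.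
  exact: (@cvg_pair _ _ _ (nbhs u) (nbhs (mxvec A)) (nbhs u) _ _ _ (fun _ => mxvec A) id (cvg_cst _) cvg_id).
have [M [_ HM]] : bounded_set ((fun u : 'rV[R]_m => ray_mass (u *m A)) @` unit_sphere m).
  by apply: compact_bounded; apply: continuous_compact => //; exact: unit_sphere_compact.
by exists (M + 1) => u u1; apply: HM; [rewrite ltrDl|exists u].
Qed.

Lemma sphere_mass_continuous (v : 'rV[R]_(m * n)) : vec_mx v *m (vec_mx v)^T = 1%:M ->
  {for v, continuous (fun v => sphere_mass (vec_mx v))}.
Proof.
move=> v1; have [M HM] := ray_mass_slice_bounded v1.
apply: (@cvg_Rintegral_uniform R 'rV[R]_(m * n) _ (borel 'rV[R]_m) (sphere_measure m)
  (unit_sphere m) (fun v u => ray_mass ((u : 'rV[R]_m) *m vec_mx v)) v M) => //.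
- exact: (@measurable_unit_sphere R m).
- by rewrite [ltLHS]sphere_measure_sphere// ltry.
- by move=> w; apply: measurable_funTS; exact: mray.
apply: near_uniform_compact; first exact: unit_sphere_compact.
by move=> u u1; exact: slice_continuous.
Qed.

Lemma sphere_massE (A : 'M[R]_(m, n)) : A *m A^T = 1%:M ->
  (\int[sphere_measure m]_(u in unit_sphere m) (ray_mass ((u : 'rV[R]_m) *m A))%:E =
   (sphere_mass A)%:E)%E.
Proof.
move=> A1; rewrite /sphere_mass /Rintegral fineK//.
have [M HM] := ray_mass_slice_bounded A1.
have mS := @measurable_unit_sphere R m.
apply: integrable_fin_num => //; apply: measurable_bounded_integrable => //.
- by rewrite [ltLHS]sphere_measure_sphere// ltry.
- by apply: measurable_funTS; exact: mray.
- exists M; split; rewrite ?num_real// => N MN u /= u1.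
  by rewrite (le_trans (HM u u1))// ltW.
Qed.

Lemma slice_mass_polar (A : 'M[R]_(m, n)) : A *m A^T = 1%:M ->
  (\int[lebesgue m]_u body_density f (K `\` L) ((u : 'rV[R]_m) *m A) = (sphere_mass A)%:E)%E.
Proof.
move=> A1; rewrite polar//; last exact: measurable_slice.
rewrite -sphere_massE//; apply: eq_integral => u; rewrite inE => u1.
rewrite -ray_massE; last exact: isometry_neq0.
by apply: eq_integral => r _; rewrite scalemxAl.
Qed.

(** Frames are encoded as row vectors, where closed bounded sets are compact.  They
    form a bounded set since their rows are unit vectors. *)
Lemma stiefel_compact : compact [set v : 'rV[R]_(m * n) | vec_mx v *m (vec_mx v : 'M[R]_(m, n))^T = 1%:M].
Proof.
apply: bounded_closed_compact.
  exists 1; split => // M M1 v /= v1.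
  apply/norm_le_cube; first by rewrite ltW// (lt_trans ltr01).
  move=> ij; case/mxvec_indexP: ij => i j.
  have -> : v ord0 (mxvec_index i j) = (row i (vec_mx v)) ord0 j by rewrite !mxE.
  apply: le_trans (coord_le_enorm _ _) _.
  rewrite (_ : enorm _ = 1) ?ltW//.
  rewrite rowE enorm_isometry//.
  apply/eqP; rewrite -(eqrXn2 (n := 2))// ?enorm_ge0// sqr_enorm expr1n.
  rewrite (bigD1 i)//= !mxE !eqxx big1 ?addr0 ?expr1n// => k ki.
  by rewrite !mxE (negbTE ki) andbF expr0n.
pose g (v : 'rV[R]_(m * n)) := vec_mx v *m (vec_mx v : 'M[R]_(m, n))^T.
have -> : [set v | g v = 1%:M] = \bigcap_ij [set v | g v ij.1 ij.2 = (1%:M : 'M[R]_m) ij.1 ij.2].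
  apply/seteqP; split => v; first by move=> /= h ij _ /=; rewrite h.
  by move=> h; apply/matrixP => i j; exact: (h (i, j) I).
apply: closed_bigI => -[i j] _ /=.
have cg : continuous (fun v => g v i j).
  move=> v; rewrite /continuous_at /g !mxE.
  under eq_cvg do rewrite mxE.
  apply: (@cvg_sumr R _ _ (nbhs v) _) => k.
  rewrite !mxE; under eq_cvg do rewrite !mxE.
  by apply: cvgM; exact: coord_continuous.
have -> : [set v | g v i j = (1%:M : 'M[R]_m) i j] = (fun v => g v i j) @^-1` [set (1%:M : 'M[R]_m) i j] by [].
by apply: closed_comp => // v _; exact: cg.
Qed.

End maximal_section.

(** * The maximal section, and the case where all sections have mass zero *)

Section maximum.
Context {R : realType} (n k : nat) (f : 'rV[R]_n -> R) (K L : set 'rV[R]_n).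
Hypotheses (kn : (k < n)%N) (cf : continuous f) (f0 : forall x, 0 <= f x).
Hypotheses (sK : star_body K) (sL : star_body L) (LK : L `<=` K).

Let m0 : (0 < n - k)%N. Proof. by rewrite subn_gt0. Qed.

Let mKL : measurable (K `\` L : set (borel 'rV[R]_n)).
Proof. by apply: measurableD; apply: closed_measurable_row; [case: sK|case: sL]. Qed.

Local Notation mass := (@sphere_mass R n (n - k)%N f K L).

Lemma sphere_mass_rotate (A : 'M[R]_(n - k, n)) Q : A *m A^T = 1%:M -> Q *m Q^T = 1%:M ->
  mass (Q *m A) = mass A.
Proof.
move=> A1 Q1.
have QA1 : (Q *m A) *m (Q *m A)^T = 1%:M.
  by rewrite trmx_mul mulmxA -(mulmxA Q) A1 mulmx1.
have eA := slice_mass_polar m0 cf f0 sK sL LK A1.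
have eQA := slice_mass_polar m0 cf f0 sK sL LK QA1.
apply: EFin_inj; apply: etrans (esym eQA) _; apply: etrans _ eA.
rewrite -(integral_lebesgue_orthogonal Q1 (measurable_slice cf A mKL)); last first.
  by move=> u; exact: body_density_ge0.
by apply: eq_integral => u _; rewrite mulmxA.
Qed.

Lemma maximal_section : exists F0 : Gr R n k,
  forall F : Gr R n k, mass (frame F) <= mass (frame F0).
Proof.
pose C := [set v : 'rV[R]_((n - k) * n) | vec_mx v *m (vec_mx v : 'M[R]_(n - k, n))^T = 1%:M].
have C0 : C !=set0 by exists (mxvec (frame (point : Gr R n k))); rewrite /C /= mxvecK frame_isometry.
have cC : compact C by exact: stiefel_compact.
have cM : {within C, continuous (fun v => mass (vec_mx v : 'M[R]_(n - k, n)))}.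
  by apply: continuous_in_subspaceT => v; rewrite inE => v1; exact: sphere_mass_continuous.
have [v] := compact_EVT_max C0 cC cM; rewrite inE => v1 vmax.
have [F0 [Q Q1 F0E]] := gr_of_isometry v1.
have E := sphere_mass_rotate v1 Q1.
exists F0 => F; rewrite F0E E.
have := vmax (mxvec (frame F)); rewrite inE /C /= mxvecK; apply.
exact: frame_isometry.
Qed.

Lemma section_mass_diff (F : Gr R n k) :
  (section_mass F f K - section_mass F f L = (mass (frame F))%:E)%E.
Proof.
have cK : closed K by case: sK.
have cL : closed L by case: sL.
have bL : bounded_set L by case: sL.
rewrite !section_massE//; try exact: closed_measurable_row.
rewrite integral_slice_diff//; last exact: frame_isometry.
by rewrite slice_mass_polar//; exact: frame_isometry.
Qed.

Lemma mass_ge0 A : 0 <= mass A :> R.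
Proof. by apply: Rintegral_ge0 => u _; exact: ray_mass_ge0. Qed.

Lemma open_gauge_lt1 : open [set x : 'rV[R]_n | gauge K x < 1].
Proof.
have -> : [set x : 'rV[R]_n | gauge K x < 1] = gauge K @^-1` [set t | t < 1] by [].
by apply: open_comp => [x _|]; [case: sK => _ _ _ _; apply|exact: open_lt].
Qed.

(** The points with [gauge K < 1], outside [L] and with [0 < f], form an open set,
    whose trace on a section through [x] would have positive measure. *)
Lemma density_vanish (x : 'rV[R]_n) : (forall F : Gr R n k, mass (frame F) = 0) ->
  x != 0 -> gauge K x < 1 -> ~ L x -> f x = 0.
Proof.
move=> M0 x0 Kx NLx; apply/eqP; rewrite eq_le f0 andbT leNgt; apply/negP => fx.
have [F xF] := gr_through kn x0.
have [u uE] : exists u, x = u *m frame F by apply/submxP; rewrite -frame_memP.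
pose U := [set y : 'rV[R]_n | gauge K y < 1] `&` ~` L `&` [set y | 0 < f y].
have oU : open U.
  apply: openI; last by apply: (@open_comp _ _ f [set t | 0 < t]) => [y _|]; [exact: cf|exact: open_gt].
  by apply: openI; [exact: open_gauge_lt1|apply: closed_openC; case: sL].
have U_u : nbhs u (fun w : 'rV[R]_(n - k) => U (w *m frame F)).
  have cm : {for u, continuous (fun w : 'rV[R]_(n - k) => w *m frame F)}.
    apply: (@cvg_mx R _ (nbhs u) _) => i j; rewrite mxE.
    under eq_cvg do rewrite mxE.
    apply: (@cvg_sumr R _ _ (nbhs u) _) => l.
    by apply: cvgM; [exact: coord_continuous|exact: cvg_cst].
  by apply: cm; apply: open_nbhs_nbhs; split => //; rewrite -uE.
have mU : measurable ([set w : 'rV[R]_(n - k) | U (w *m frame F)] : set (borel 'rV[R]_(n - k))).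
  have := @measurable_mulmx R _ _ (frame F) measurableT U.
  by rewrite setTI; apply; exact: sub_sigma_algebra.
have pos := lebesgue_nbhs mU U_u.
have := slice_mass_polar (m := (n - k)%N) m0 cf f0 sK sL LK (frame_isometry F).
rewrite M0 => I0.
have ms := measurable_slice cf (frame F) mKL.
have /(ae_eq_integral_abs _ measurableT ms)[N [mN N0 NS]] : (\int[lebesgue (n - k)]_w
    `|body_density f (K `\` L) ((w : 'rV[R]_(n - k)) *m frame F)| = 0)%E.
  by rewrite -[RHS]I0; apply: eq_integral => w _; rewrite gee0_abs// body_density_ge0.
have UN : [set w : 'rV[R]_(n - k) | U (w *m frame F)] `<=` N.
  move=> w [[Kw NLw] fw]; apply: NS => /= /(_ I).
  rewrite /body_density indicE mem_set; last first.
    by split => //; apply/gauge_le1 => //; exact: ltW.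
  by rewrite mul1r => -[fw0]; move: fw; rewrite /= fw0 ltxx.
have : (lebesgue (n - k) [set w : borel 'rV[R]_(n - k) | U ((w : 'rV[R]_(n - k)) *m frame F)] <= lebesgue (n - k) N)%E.
  by apply: le_measure => //; rewrite inE.
by rewrite N0 leNgt pos.
Qed.

(** By [density_vanish] the integrand along a ray can be nonzero only where the
    ray crosses the boundary of [K], which is a single point. *)
Lemma body_mass_vanish : (forall F : Gr R n k, mass (frame F) = 0) ->
  (\int[lebesgue n]_x body_density f (K `\` L) x = 0)%E.
Proof.
move=> M0; have n0 : (0 < n)%N by exact: leq_ltn_trans kn.
have mh := measurable_body_density cf mKL.
have h0 := body_density_ge0 f0 (K `\` L).
rewrite polar//; apply: integral0_eq => x x1; have x0 := sphere_neq0 x1.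
rewrite /ray_integral.
have mr : measurable_fun setT (fun r : measurableTypeR R => ((ray_weight n r)%:E * body_density f (K `\` L) (r *: x))%E).
  exact: (measurableT_comp (measurable_ray_integrand n mh) (pair1_measurable (x : borel 'rV[R]_n))).
rewrite (@ge0_negligible_integral _ _ _ lebesgue_measure setT [set (gauge K x)^-1])//; last 2 first.
- by move=> r _; exact: ray_integrand_ge0.
- exact: lebesgue_measure_set1.
apply: integral0_eq => r [_ /= rN].
rewrite /ray_weight; case: ifPn => r0; last by rewrite mul0e.
rewrite /body_density indicE; case: (boolP (_ \in _)) => [|_]; last by rewrite mul0r mule0.
rewrite inE => -[Krx NLrx].
rewrite density_vanish ?mulr0 ?mule0//; first by rewrite scaler_eq0 negb_or gt_eqF.
move: Krx => /gauge_le1 -/(_ sK); rewrite le_eqVlt => /predU1P[|//].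
rewrite gaugeZ// => E; exfalso; apply: rN.
by rewrite -[RHS]mul1r -E mulfK// gt_eqF// gauge_gt0.
Qed.

End maximum.

(** * Comparison with a star body containing K *)

Section volume.
Context {R : realType}.

Lemma segment_integral1 n m (y : 'rV[R]_n) : (0 < m)%N ->
  segment_integral m (fun=> 1) y = m%:R^-1.
Proof.
case: m => // m _; rewrite /segment_integral /Rintegral /=.
have c (l : R) j : continuous (fun x : R => l * x ^+ j).
  by move=> x; apply: cvgM; [exact: cvg_cst|exact: exprn_continuous].
rewrite (@continuous_FTC2 _ _ (fun x => m.+1%:R^-1 * x ^+ m.+1) 0 1)//=.
- by rewrite expr1n mulr1 expr0n/= mulr0 subr0.
- apply: continuous_subspaceT => x.
  by apply: cvgM; [exact: exprn_continuous|exact: cvg_cst].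
- split.
  + by move=> x _; apply: derivableM => //; exact: exprn_derivable.
  + by apply: cvg_at_right_filter; exact: c.
  + by apply: cvg_at_left_filter; exact: c.
- move=> x _; rewrite derive1Ml; last exact: exprn_derivable.
  by rewrite exp_derive1 /GRing.scale /= mulr1 mulrA mulVf ?mul1r ?mulr1// pnatr_eq0.
Qed.

Lemma measurable_radial n (D : set 'rV[R]_n) : star_body D ->
  measurable_fun setT (radial D : borel 'rV[R]_n -> measurableTypeR R).
Proof.
move=> sD; rewrite [X in measurable_fun _ X](_ : _ = fun x => gauge D x `^ (-1)); last first.
  by apply/funext => x; rewrite powR_inv1//; exact: gauge_ge0.
apply: (measurableT_comp (measurable_powR (-1))).
by apply: continuous_measurable_row; case: sD.
Qed.

Lemma radial_ge0 n (D : set 'rV[R]_n) x : star_body D -> 0 <= radial D x.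
Proof. by move=> sD; rewrite invr_ge0 gauge_ge0. Qed.

Lemma star_measurable n (D : set 'rV[R]_n) : star_body D -> measurable (D : set (borel 'rV[R]_n)).
Proof. by move=> sD; apply: closed_measurable_row; case: sD. Qed.

Lemma star_volE n (D : set 'rV[R]_n) : star_body D -> lebesgue n D = (vol D)%:E.
Proof.
move=> sD; rewrite /vol fineK// ge0_fin_numE// lebesgue_bounded//.
  exact: star_measurable.
by case: sD.
Qed.

Lemma star_vol_gt0 n (D : set 'rV[R]_n) : star_body D -> 0 < vol D.
Proof.
move=> sD; rewrite -lte_fin -star_volE//; apply: (@lebesgue_nbhs _ _ _ 0).
  exact: star_measurable.
by case: sD.
Qed.

(** Polar coordinates for the indicator function of [D]. *)
Lemma star_volume n (D : set 'rV[R]_n) : (0 < n)%N -> star_body D ->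
  (\int[sphere_measure n]_(x in unit_sphere n) (radial D x ^+ n)%:E = (n%:R * vol D)%:E)%E.
Proof.
move=> n0 sD; have mD := star_measurable sD.
have c1 : continuous (fun _ : 'rV[R]_n => 1 : R) by exact: cst_continuous.
have p1 (x : 'rV[R]_n) : 0 <= (1 : R) by [].
have mS := @measurable_unit_sphere R n.
rewrite EFinM -star_volE//.
have -> : (lebesgue n D = \int[lebesgue n]_x body_density (fun _ : 'rV[R]_n => 1%R : R) D x)%E.
  under eq_integral do rewrite /body_density mulr1.
  by rewrite (integral_indic _ measurableT mD) setIT.
rewrite polar//; last 2 first.
- exact: (measurable_body_density c1 mD).
- by move=> x; exact: (body_density_ge0 p1 D).
rewrite -ge0_integralZl_EFin//; last 2 first.
- by move=> x _; apply: ray_integral_ge0 => y; exact: (body_density_ge0 p1 D).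
- apply: measurable_funTS.
  exact: (measurable_ray_integral n (measurable_body_density c1 mD) (body_density_ge0 p1 D)).
apply: eq_integral => x; rewrite inE => x1.
rewrite (ray_integral_star c1 p1 n0 sD (sphere_neq0 x1)).
by rewrite segment_integral1// -EFinM mulrCA mulfV ?mulr1// pnatr_eq0 -lt0n.
Qed.

End volume.

(** The integral of a nonnegative function, measurable or not, is the supremum of
    the integrals of the simple functions below it.  In this form monotonicity
    applies directly to the Radon transform as a function on the Grassmannian. *)
Lemma ge0_le_integral_any d (T : measurableType d) (R : realType)
    (mu : {measure set T -> \bar R}) (f g : T -> \bar R) :
  (forall x, 0 <= f x)%E -> (forall x, f x <= g x)%E ->
  (\int[mu]_x f x <= \int[mu]_x g x)%E.
Proof.
move=> f0 fg; have g0 x : (0 <= g x)%E by exact: le_trans (f0 x) (fg x).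
rewrite !ge0_integralTE//; apply: ereal_sup_le.
by move=> _ [h hf <-]; exists h => // x; exact: le_trans (hf x) (fg x).
Qed.

(** Young's inequality with the conjugate exponents [(k + m) / k] and
    [(k + m) / m]. *)
Lemma young_pow (R : realType) (a t : R) (k m : nat) : (0 < k)%N -> (0 < m)%N ->
  0 <= a -> 0 <= t ->
  (k + m)%:R * (a ^+ k * t ^+ m) <= k%:R * a ^+ (k + m) + m%:R * t ^+ (k + m).
Proof.
move=> k0 m0 a0 t0.
have kR : 0 < k%:R :> R by rewrite ltr0n.
have mR : 0 < m%:R :> R by rewrite ltr0n.
pose n : R := (k + m)%:R.
have nE : n = k%:R + m%:R by rewrite /n natrD.
have nR : 0 < n by rewrite nE addr_gt0.
have := @conjugate_powR R (a ^+ k) (t ^+ m) (n / k%:R) (n / m%:R)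
  (exprn_ge0 _ a0) (exprn_ge0 _ t0) (divr_gt0 nR kR) (divr_gt0 nR mR).
have pE (b : R) j : 0 < j%:R :> R -> 0 <= b -> (b ^+ j) `^ (n / j%:R) = b ^+ (k + m).
  move=> jR b0; rewrite -powR_mulrn// -powRrM mulrCA mulfV ?gt_eqF// mulr1.
  by rewrite powR_mulrn.
rewrite !pE// !invf_div -mulrDl -nE mulfV ?gt_eqF// => /(_ erefl).
rewrite -(ler_pM2l nR) => h; apply: le_trans h _.
rewrite le_eqVlt; apply/orP; left; apply/eqP.
by field; rewrite -nE gt_eqF.
Qed.

Section comparison.
Context {R : realType} (n k : nat) (f : 'rV[R]_n -> R) (K L D : set 'rV[R]_n).
Hypotheses (k0 : (0 < k)%N) (kn : (k < n)%N).
Hypotheses (cf : continuous f) (f0 : forall x, 0 <= f x).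
Hypotheses (sK : star_body K) (sL : star_body L) (LK : L `<=` K).
Hypotheses (sD : star_body D) (KD : K `<=` D).

Let m := (n - k)%N.
Let m0 : (0 < m)%N. Proof. by rewrite subn_gt0. Qed.
Let n0 : (0 < n)%N. Proof. exact: leq_ltn_trans kn. Qed.
Let nkm : (k + m = n)%N. Proof. by rewrite subnKC// ltnW. Qed.

Let mKL : measurable (K `\` L : set (borel 'rV[R]_n)).
Proof. by apply: measurableD; exact: star_measurable. Qed.

Local Notation h := (body_density f (K `\` L)).
Local Notation g := (ray_mass m f K L).

Let mh : measurable_fun setT h := measurable_body_density cf mKL.
Let h0 : forall x, (0 <= h x)%E := body_density_ge0 f0 (K `\` L).

(** Since [K `\` L] is contained in [D], the ray meets it only at times
    [r <= radial D x], where [r ^+ n.-1 <= radial D x ^+ k * r ^+ (n - k).-1]. *)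
Lemma ray_integral_le (x : 'rV[R]_n) : x != 0 ->
  (ray_integral n h x <= (radial D x ^+ k * g x)%:E)%E.
Proof.
move=> x0; rewrite EFinM -ray_massE//.
have r0 := radial_ge0 x sD.
have gD := gauge_gt0 sD x0.
have mi j : measurable_fun setT (fun r : measurableTypeR R => ((ray_weight j r)%:E * h (r *: x))%E).
  exact: (measurableT_comp (measurable_ray_integrand j mh) (pair1_measurable (x : borel 'rV[R]_n))).
rewrite -ge0_integralZl_EFin ?exprn_ge0//; last by move=> r _; exact: ray_integrand_ge0.
apply: ge0_le_integral => //.
- by move=> r _; exact: ray_integrand_ge0.
- by apply: emeasurable_funM => //; exact: measurable_cst.
move=> r _; rewrite /ray_weight; case: ifPn => rp; last by rewrite !mul0e mule0.
rewrite /body_density -!EFinM lee_fin indicE.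
case: (boolP (_ \in _)) => [|_]; last by rewrite !mul0r !mulr0.
rewrite inE => -[Kr _]; rewrite mul1r mulrA ler_wpM2r//.
have -> : (n.-1 = k + m.-1)%N by rewrite -nkm -(prednK m0) addnS.
rewrite exprD ler_wpM2r ?exprn_ge0 ?(ltW rp)//.
rewrite lerXn2r ?nnegrE ?(ltW rp)// /radial.
have := (gauge_le1 (r *: x) sD).1 (KD Kr).
by rewrite gaugeZ// -ler_pdivlMr ?mul1r.
Qed.

Lemma body_mass_le :
  (\int[lebesgue n]_x h x <=
   \int[sphere_measure n]_(x in unit_sphere n) (radial D x ^+ k * g x)%:E)%E.
Proof.
have mS := @measurable_unit_sphere R n.
rewrite polar//; apply: ge0_le_integral => //.
- by move=> x _; exact: ray_integral_ge0.
- by apply: measurable_funTS; exact: measurable_ray_integral.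
- apply: measurable_funTS; apply/measurable_EFinP; apply: measurable_funM.
    by apply: measurable_funX; exact: measurable_radial.
  exact: measurable_ray_mass.
- by move=> x x1; apply: ray_integral_le; exact: sphere_neq0.
Qed.

(** The frame is an isometry of R^(n-k) onto [F], so both integrals run over the
    same unit sphere. *)
Lemma radonE (F : Gr R n k) (p : 'rV[R]_n -> R) :
  measurable_fun setT (p : borel 'rV[R]_n -> measurableTypeR R) -> (forall x, 0 <= p x) ->
  (radon F p = \int[sphere_measure m]_(u in unit_sphere m) (p ((u : 'rV[R]_m) *m frame F))%:E)%E.
Proof.
move=> mp p0; have mS := @measurable_unit_sphere R n.
have mSF : measurable (unit_sphere n `&` [set` val F] : set (borel 'rV[R]_n)).
  by apply: measurableI => //; exact: measurable_gr.
rewrite /radon integral_image_measure//; last first.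
  by apply: measurable_funTS; exact/measurable_EFinP.
congr (integral _ _ _); apply/seteqP; split => u; rewrite /embed /=.
  by move=> [+ _]; rewrite /unit_sphere/= enorm_isometry//; exact: frame_isometry.
move=> u1; split; last exact: frame_in.
by rewrite /unit_sphere/= enorm_isometry//; exact: frame_isometry.
Qed.

Lemma radon1 (F : Gr R n k) : radon F (fun=> 1) = (m%:R * omega R m)%:E.
Proof.
rewrite (@radonE F (fun=> 1) (@measurable_cst _ _ _ _ _ _) (fun=> ler01)).
rewrite integral_cst ?mul1e; last exact: (@measurable_unit_sphere R m).
exact: sphere_measure_sphere.
Qed.

(** Hoelder's inequality in the form of Young's inequality for [radial D x] and a
    constant [t], optimized over [t]; the optimal [t ^+ n] is the mean of
    [radial D x ^+ n] over the sphere, which is the ratio of the volumes of [D]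
    and of the unit ball. *)
Lemma radial_moment_le :
  (\int[sphere_measure n]_(x in unit_sphere n) (radial D x ^+ k)%:E <=
   (n%:R * (omega R n `^ (m%:R / n%:R) * vol D `^ (k%:R / n%:R)))%:E)%E.
Proof.
have mS := @measurable_unit_sphere R n.
have V0 := star_vol_gt0 sD; have w0 := @omega_gt0 R n.
have nR : 0 < n%:R :> R by rewrite ltr0n.
set V := vol D in V0 *; set w := omega R n in w0 *.
(* [t ^+ n] is the mean of [radial D x ^+ n]; it balances the two terms of Young's
   inequality. *)
pose t := (V / w) `^ n%:R^-1.
have t0 : 0 < t by rewrite powR_gt0// divr_gt0.
have tE j : t ^+ j = (V / w) `^ (j%:R / n%:R).
  by rewrite -powR_mulrn ?(ltW t0)// /t -powRrM [n%:R^-1 * _]mulrC.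
have tn : t ^+ n = V / w by rewrite tE mulfV ?gt_eqF// powRr1// ltW// divr_gt0.
set I := (\int[_]_(x in _) _)%E.
have mr j : measurable_fun (unit_sphere n : set (borel 'rV[R]_n)) (fun x => (radial D x ^+ j)%:E).
  by apply: measurable_funTS; apply/measurable_EFinP; apply: measurable_funX; exact: measurable_radial.
have Y : ((n%:R * t ^+ m)%:E * I <= (n%:R * V * n%:R)%:E)%E.
  rewrite /I -ge0_integralZl_EFin//; last 2 first.
  - by move=> x _; rewrite lee_fin exprn_ge0// radial_ge0.
  - by rewrite mulr_ge0// exprn_ge0// ltW.
  apply: (@le_trans _ _ (\int[sphere_measure n]_(x in unit_sphere n)
     ((k%:R)%:E * (radial D x ^+ n)%:E + (m%:R * t ^+ n)%:E))%E).
    apply: ge0_le_integral => //.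
    - by move=> x _; rewrite -EFinM lee_fin !mulr_ge0 ?exprn_ge0 ?radial_ge0// ltW.
    - by apply: emeasurable_funM => //; exact: measurable_cst.
    - by apply: emeasurable_funD; [apply: emeasurable_funM => //|]; exact: measurable_cst.
    - move=> x _; rewrite -!EFinM -EFinD lee_fin.
      have := young_pow k0 m0 (radial_ge0 x sD) (ltW t0).
      by rewrite nkm -mulrA (mulrC (t ^+ m)).
  rewrite ge0_integralD//; last 3 first.
  - by move=> x _; rewrite -EFinM lee_fin mulr_ge0// exprn_ge0// radial_ge0.
  - by apply: emeasurable_funM => //; exact: measurable_cst.
  - by move=> x _; rewrite lee_fin mulr_ge0// exprn_ge0// ltW.
  rewrite ge0_integralZl_EFin//; last by move=> x _; rewrite lee_fin exprn_ge0// radial_ge0.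
  have -> : (\int[sphere_measure n]_(x in unit_sphere n) (m%:R * t ^+ n)%:E =
      (m%:R * t ^+ n * (n%:R * w))%:E)%E.
    by rewrite integral_cst// [RHS]EFinM; congr (_ * _)%E; exact: sphere_measure_sphere.
  rewrite star_volume// -EFinM -EFinD lee_fin tn -/V.
  have -> : m%:R * (V / w) * (n%:R * w) = m%:R * (n%:R * V) :> R by field; rewrite gt_eqF.
  by rewrite -mulrDl -natrD nkm mulrC.
have tm0 : 0 < t ^+ m by rewrite exprn_gt0.
have : (I <= (n%:R * V / t ^+ m)%:E)%E.
  have I0 : (0 <= I)%E by apply: integral_ge0 => x _; rewrite lee_fin exprn_ge0// radial_ge0.
  have Q0 : 0 < n%:R * t ^+ m by rewrite mulr_gt0.
  rewrite -(@lee_pmul2l _ (n%:R * t ^+ m)%:E)//.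
  apply: le_trans Y _; rewrite -EFinM lee_fin le_eqVlt; apply/orP; left; apply/eqP.
  by field; rewrite gt_eqF.
move=> h1; apply: le_trans h1 _.
rewrite lee_fin -mulrA ler_pM2l// tE le_eqVlt; apply/orP; left; apply/eqP.
have Vw0 : 0 < V / w by rewrite divr_gt0.
have VE : V = (V / w) `^ (m%:R / n%:R) * w `^ (m%:R / n%:R) * V `^ (k%:R / n%:R).
  rewrite -powRM ?(ltW Vw0) ?(ltW w0)// mulfVK ?gt_eqF// -powRD; last first.
    by apply/implyP => _; rewrite gt_eqF.
  by rewrite -mulrDl -natrD addnC nkm mulfV ?gt_eqF// powRr1// ltW.
have P0 : 0 < (V / w) `^ (m%:R / n%:R) by rewrite powR_gt0.
set P := (V / w) `^ _ in VE P0 *.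
by rewrite {1}VE -!mulrA mulrC !mulrA mulfVK// gt_eqF.
Qed.

End comparison.

(** * The inequality *)

Lemma c_nk_pow (R : realType) (n k : nat) : (0 < k)%N ->
  c_nk R n k ^+ k = omega R n `^ ((n - k)%N%:R / n%:R) / omega R (n - k).
Proof.
move=> k0; rewrite /c_nk -powR_mulrn ?powR_ge0// -powRrM mulVf ?pnatr_eq0 -?lt0n//.
by rewrite powRr1// divr_ge0 ?powR_ge0// ltW// omega_gt0.
Qed.

Section main_inequality.
Context {R : realType} (n k : nat) (f : 'rV[R]_n -> R) (K L : set 'rV[R]_n).
Hypotheses (k0 : (0 < k)%N) (kn : (k < n)%N).
Hypotheses (cf : continuous f) (f0 : forall x, 0 <= f x).
Hypotheses (sK : star_body K) (sL : star_body L) (LK : L `<=` K).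

Let m0 : (0 < n - k)%N. Proof. by rewrite subn_gt0. Qed.

Local Notation mass := (@sphere_mass R n (n - k)%N f K L).

(** The measure representing [D] is tested against [ray_mass], which brings in the
    section masses, and against the constant 1, which gives its total mass. *)
Lemma body_mass_le_intersection (D : set 'rV[R]_n) (M : R) :
  gen_intersection_body k D -> K `<=` D -> 0 <= M ->
  (forall F : Gr R n k, mass (frame F) <= M) ->
  (\int[lebesgue n]_x body_density f (K `\` L) x <=
   (n%:R / (n - k)%N%:R * c_nk R n k ^+ k * vol D `^ (k%:R / n%:R) * M)%:E)%E.
Proof.
move=> [sD _ [nu nuE]] KD M0 FM.
have mR : 0 < (n - k)%N%:R :> R by rewrite ltr0n.
have wm := @omega_gt0 R (n - k).
have c1 : {within unit_sphere n, continuous (fun _ : 'rV[R]_n => 1 : R)}.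
  by apply: continuous_subspaceT; exact: cst_continuous.
have cg : {within unit_sphere n, continuous (ray_mass (n - k) f K L : 'rV[R]_n -> R)}.
  apply: continuous_in_subspaceT => x; rewrite inE => x1.
  by apply: ray_mass_continuous => //; exact: sphere_neq0.
have nuT : ((((n - k)%N%:R * omega R (n - k))%:E * nu setT) <=
    (n%:R * (omega R n `^ ((n - k)%N%:R / n%:R) * vol D `^ (k%:R / n%:R)))%:E)%E.
  rewrite -(integral_cst nu measurableT).
  have -> : (\int[nu]_F ((n - k)%N%:R * omega R (n - k))%:E = \int[nu]_F radon F (fun=> 1%R))%E.
    by apply: eq_integral => F _; rewrite (radon1 kn F).
  rewrite -(nuE _ c1); under eq_integral do rewrite mulr1.
  exact: radial_moment_le.
apply: le_trans (body_mass_le kn cf f0 sK sL LK sD KD) _.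
rewrite (nuE _ cg).
apply: (@le_trans _ _ (M%:E * nu setT)%E).
  rewrite -(integral_cst nu measurableT); apply: ge0_le_integral_any => F.
    by apply: integral_ge0 => x _; rewrite lee_fin ray_mass_ge0.
  rewrite (@radonE _ n k); last 2 first.
  - exact: measurable_ray_mass.
  - by move=> x; exact: ray_mass_ge0.
  by rewrite sphere_massE ?lee_fin//; exact: frame_isometry.
have q0 : 0 < (n - k)%N%:R * omega R (n - k) by rewrite mulr_gt0.
rewrite -(@lee_pmul2l _ ((n - k)%N%:R * omega R (n - k))%:E)// muleCA.
apply: (@le_trans _ _ (M%:E * (n%:R * (omega R n `^ ((n - k)%N%:R / n%:R) * vol D `^ (k%:R / n%:R)))%:E)%E).
  by apply: lee_wpmul2l; rewrite ?lee_fin.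
rewrite -!EFinM lee_fin c_nk_pow// le_eqVlt; apply/orP; left; apply/eqP.
by field; rewrite !gt_eqF.
Qed.

(** The whole space is treated as the section with frame [1%:M]. *)
Lemma mass_body_diff (mu : {measure set (borel 'rV[R]_n) -> \bar R}) : has_density mu f ->
  (mu K - mu L = \int[lebesgue n]_x body_density f (K `\` L) x)%E.
Proof.
move=> muE.
have cK : closed K by case: sK.
have cL : closed L by case: sL.
have bL : bounded_set L by case: sL.
have muB (B : set (borel 'rV[R]_n)) : measurable B ->
    (mu B = \int[lebesgue n]_x body_density f B ((x : 'rV[R]_n) *m 1%:M))%E.
  move=> mB; rewrite muE// integral_mkcond; apply: eq_integral => x _.
  rewrite mulmx1 /patch /body_density indicE.
  by case: ifPn => _; rewrite ?mul1r ?mul0r.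
rewrite !muB; try exact: closed_measurable_row.
rewrite (integral_slice_diff cf f0)//; last by rewrite trmx1 mulmx1.
by apply: eq_integral => x _; rewrite mulmx1.
Qed.

End main_inequality.

Lemma expey (R : realType) (k : nat) : (0 < k)%N -> ((+oo : \bar R) ^+ k = +oo)%E.
Proof.
case: k => // k _; elim: k => [|k IH]; first by rewrite expeS expe0 mule1.
by rewrite expeS IH mulyy.
Qed.

(** Bounds by all [v] in [S] pass to their infimum.  If [S] is empty, the infimum is
    [+oo] and the right-hand side is [+oo] for [b > 0] but 0 for [b = 0]; the
    hypothesis on [b = 0] covers this last case. *)
Lemma le_mul_expe_inf (R : realType) (S : set R) (k : nat) (a b C : R) :
  (0 < k)%N -> 0 < C -> 0 <= b -> (b = 0 -> a <= 0) ->
  (forall v, S v -> 0 <= v) ->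
  (forall v, S v -> a <= C * v ^+ k * b) ->
  (a%:E <= C%:E * (ereal_inf (EFin @` S)) ^+ k * b%:E)%E.
Proof.
move=> k0 C0 b0 ab S0 aS.
have i0 : (0 <= ereal_inf (EFin @` S))%E.
  by apply: le_ereal_inf_tmp => _ [v Sv <-]; rewrite lee_fin S0.
have [a0|a0] := leP a 0.
  apply: le_trans (_ : 0 <= _)%E; first by rewrite lee_fin.
  by rewrite !mule_ge0 ?expe_ge0// lee_fin// ltW.
have {b0} b0 : 0 < b.
  by rewrite lt_neqAle b0 andbT; apply/eqP => bE; move: a0; rewrite ltNge ab.
have Cb : 0 < C * b by rewrite mulr_gt0.
(* [q] is the value of [v] at which the bound would be an equality. *)
pose q := (a / (C * b)) `^ k%:R^-1.
have q0 : 0 <= q by rewrite powR_ge0.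
have qk : q ^+ k = a / (C * b).
  rewrite -powR_mulrn// -powRrM mulVf ?pnatr_eq0 -?lt0n// powRr1//.
  by rewrite divr_ge0// ltW.
have qi : (q%:E <= ereal_inf (EFin @` S))%E.
  apply: le_ereal_inf_tmp => _ [v Sv <-]; rewrite lee_fin.
  rewrite -(@ler_pXn2r _ k)// ?nnegrE ?S0// qk ler_pdivrMr//.
  by rewrite mulrA (mulrC _ C) aS.
have qki : ((a / (C * b))%:E <= (ereal_inf (EFin @` S)) ^+ k)%E.
  rewrite -qk; move: qi i0; case: (ereal_inf _) => [r| |] //.
    by rewrite !lee_fin -EFin_expe => qr r0; rewrite lee_fin lerXn2r.
  by move=> _ _; rewrite expey// leey.
apply: (@le_trans _ _ (C%:E * (a / (C * b))%:E * b%:E)%E).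
  rewrite -!EFinM lee_fin le_eqVlt; apply/orP; left; apply/eqP.
  by field; rewrite (gt_eqF C0) (gt_eqF b0).
by rewrite lee_wpmul2r ?lee_fin ?(ltW b0)// lee_wpmul2l// lee_fin ltW.
Qed.

Theorem theorem1p4 (R : realType) (n k : nat) (K L : set 'rV[R]_n)
    (mu : {measure set (borel 'rV[R]_n) -> \bar R}) (f : 'rV[R]_n -> R) :
  (1 <= k)%N -> (k < n)%N ->
  star_body K -> origin_symmetric K ->
  star_body L -> origin_symmetric L ->
  L `<=` K ->
  continuous f -> (forall x, 0 <= f x) -> (forall x, f (- x) = f x) ->
  has_density mu f ->
  exists2 F0 : Gr R n k,
    (forall F : Gr R n k,
       section_mass F f K - section_mass F f L <=
       section_mass F0 f K - section_mass F0 f L)%E &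
    (mu K - mu L <=
       (n%:R / (n - k)%N%:R * c_nk R n k ^+ k * vol K `^ (k%:R / n%:R))%:E *
       d_ovr k K ^+ k *
       (section_mass F0 f K - section_mass F0 f L))%E.
Proof.
move=> k0 kn sK _ sL _ LK cf f0 _ muE.
have [F0 F0max] := maximal_section kn cf f0 sK sL LK.
exists F0 => [F|].
  by rewrite !(section_mass_diff kn cf f0 sK sL LK) lee_fin.
rewrite (section_mass_diff kn cf f0 sK sL LK) (mass_body_diff cf f0 sK sL LK muE).
set M := sphere_mass f K L (frame F0).
have M0 : 0 <= M by exact: mass_ge0.
have n0 : (0 < n)%N by exact: leq_ltn_trans kn.
have nR : 0 < n%:R :> R by rewrite ltr0n.
have mR : 0 < (n - k)%N%:R :> R by rewrite ltr0n subn_gt0.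
have VK := star_vol_gt0 sK.
set C := _ * _ * _.
have C0 : 0 < C.
  rewrite mulr_gt0 ?powR_gt0// mulr_gt0 ?divr_gt0// c_nk_pow//.
  by rewrite divr_gt0 ?powR_gt0// omega_gt0.
have [H HE] : exists H : R, (\int[lebesgue n]_x body_density f (K `\` L) x = H%:E)%E.
  exists (sphere_mass f K L (1%:M : 'M[R]_n)).
  rewrite -(slice_mass_polar n0 cf f0 sK sL LK); last by rewrite trmx1 mulmx1.
  by apply: eq_integral => x _; rewrite mulmx1.
rewrite HE.
pose S := [set (vol D / vol K) `^ n%:R^-1 | D in [set D | K `<=` D /\ gen_intersection_body k D]].
have -> : d_ovr k K = ereal_inf (EFin @` S).
  by rewrite /d_ovr /S -image_comp.
apply: le_mul_expe_inf => //.
- move=> ME.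
  have MF (F : Gr R n k) : sphere_mass f K L (frame F) = 0.
    apply: le_anti; apply/andP; split; last exact: mass_ge0.
    by rewrite -[leRHS]ME; exact: F0max.
  have := etrans (esym HE) (body_mass_vanish kn cf f0 sK sL LK MF).
  by case=> ->.
- by move=> _ [D _ <-]; exact: powR_ge0.
move=> _ [D [KD bD] <-]; rewrite -lee_fin -HE.
have sD : star_body D by case: bD.
have VD := star_vol_gt0 sD.
apply: le_trans (body_mass_le_intersection k0 kn cf f0 sK sL LK bD KD M0 F0max) _.
rewrite lee_fin le_eqVlt; apply/orP; left; apply/eqP.
congr (_ * _); rewrite /C -!mulrA; congr (_ * (_ * (_ * _))).
rewrite -powR_mulrn ?powR_ge0// -powRrM (mulrC _ k%:R) -powRM ?(ltW VK)//; last by rewrite divr_ge0// ltW.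
by rewrite mulrCA mulfV ?mulr1// gt_eqF.
Qed.
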